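(* Let $P\in\mathcal{P}(d,n,s)$ with distinguished facet $F$, and let $P'=\partial P-\{F\}$. Then \[h_k(P')\le\binom{n-d-1+k}{k}\quad\text{for }0\le k\le\lfloor (d-1)/2\rfloor,\] \[h_{d-k}(P')\le\binom{n-d-1+k}{k}-\binom{s+k-1}{k}\quad\text{for }1\le k\le\lfloor d/2\rfloor.\] Consequently $f_{i-1}(P)\le f_{i-1}(C(d,n,s))$ for $i=1,2,\dots,d$. Moreover, equality $f_{i-1}(P)=f_{i-1}(C(d,n,s))$ for some $i$ with $\lfloor (d-1)/2\rfloor\le i\le d$ implies that $P$ is $\lfloor (d-1)/2\rfloor$-neighbourly.
   Context: $\mathcal{P}(d,n,s)$ is the family of $d$-polytopes with $n$ vertices having a facet $F$ with exactly $d+s$ vertices such that every other facet is a simplex. $P'$ is the simplicial $(d-1)$-ball of all faces of facets of $P$ other than $F$. For a $(d-1)$-dimensional simplicial complex $\Delta$ with $f_{i-1}(\Delta)$ faces of $i$ vertices ($f_{-1}=1$), $h_k(\Delta)=\sum_{i=0}^k(-1)^{k-i}\binom{d-i}{k-i}f_{i-1}(\Delta)$. $f_{i-1}(P)$ is the number of $(i-1)$-faces of $P$. $C(d,n,s)=\mathrm{conv}\{y(t_1),\dots,y(t_n)\}$ with $t_i=-s-d+i$, $y(t)=(t,\dots,t^{d-1},p(t))$, $p(t)=(n-1)^{(t-1)(d-1)}\,t(t+1)\cdots(t+d+s-1)$. A polytope is $k$-neighbourly if every set of at most $k$ vertices is the vertex set of a face. *)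

(* Defs.v *)
From mathcomp Require Import all_boot all_order all_algebra.
From mathcomp Require Import finmap.
From mathcomp Require Import boolp classical_sets functions cardinality reals.

Set Implicit Arguments.
Unset Strict Implicit.
Unset Printing Implicit Defensive.

Import Order.TTheory GRing.Theory Num.Theory.

Local Open Scope classical_set_scope.
Local Open Scope card_scope.
Local Open Scope ring_scope.

(* [fset_set A] is empty when [A] is infinite; below this is only applied to
   families of faces of a polytope, which are finite. *)
Definition cardset (T : choiceType) (A : set T) : nat := (#|` fset_set A|)%fset.

Section Polytopes.
Variables (R : realType) (m : nat).
Local Notation V := 'rV[R]_m.

Definition conv (k : nat) (p : 'I_k -> V) : set V :=
  [set x | exists w : 'I_k -> R,
    [/\ forall i, 0 <= w i, \sum_i w i = 1 & x = \sum_i w i *: p i]].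

Definition aff (k : nat) (p : 'I_k -> V) : set V :=
  [set x | exists w : 'I_k -> R,
    \sum_i w i = 1 /\ x = \sum_i w i *: p i].

Definition affinely_independent (k : nat) (p : 'I_k -> V) : Prop :=
  forall w : 'I_k -> R,
    \sum_i w i = 0 -> \sum_i w i *: p i = 0 -> forall i, w i = 0.

(* The affine dimension of [A] is [e]; the empty set has dimension -1. *)
Definition has_dim (A : set V) (e : int) : Prop :=
  exists (k : nat) (p : 'I_k -> V),
    [/\ e = k%:Z - 1, forall i, A (p i), affinely_independent p
      & A `<=` aff p].

Definition polytope (P : set V) : Prop :=
  exists (k : nat) (p : 'I_k -> V), P = conv p.

Definition simplex (P : set V) : Prop :=
  exists (k : nat) (p : 'I_k -> V), affinely_independent p /\ P = conv p.

(* The improper faces [set0] (c = 0, b = 1) and [P] (c = 0, b = 0) are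
   included. *)
Definition face (P G : set V) : Prop :=
  exists (c : V) (b : R),
    (forall x, P x -> \sum_j c 0 j * x 0 j <= b) /\
    G = P `&` [set x | \sum_j c 0 j * x 0 j = b].

Definition facet (d : nat) (P G : set V) : Prop :=
  face P G /\ has_dim G (d%:Z - 1).

Definition vertices (P : set V) : set V := [set v | face P [set v]].

Definition face_count (P : set V) (e : int) : nat :=
  cardset [set G | face P G /\ has_dim G e].

Definition neighbourly (k : nat) (P : set V) : Prop :=
  forall S : set V, S `<=` vertices P -> S #<= `I_k ->
    exists G, face P G /\ vertices G = S.

Definition almost_simplicial (d n s : nat) (P F : set V) : Prop :=
  [/\ polytope P /\ has_dim P d%:Z,
      vertices P #= `I_n,
      facet d P F,
      vertices F #= `I_(d + s)
    & forall G, facet d P G -> G <> F -> simplex G].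

Definition boundary_minus (d : nat) (P F : set V) : set (set V) :=
  [set G | exists H, [/\ facet d P H, H <> F & face H G]].

(* A (geometric) simplicial complex is the set of its simplices, including
   the empty one; [complex_count D i] is f_{i-1}(D). *)
Definition complex_count (D : set (set V)) (i : nat) : nat :=
  cardset [set G | D G /\ vertices G #= `I_i].

Definition h_number (d : nat) (D : set (set V)) (k : nat) : int :=
  \sum_(i < k.+1)
    (-1) ^+ (k - i) * 'C(d - i, k - i)%:Z * (complex_count D i)%:Z.

End Polytopes.

Section MaximizerPolytope.
Variables (R : realType) (d n s : nat).

(* For t <= 0 the exponent is nonpositive; at the parameters t = 1-d-s, ..., 0
   used below, the product vanishes anyway. *)
Definition pC (t : int) : R :=
  (n%:R - 1) ^ ((t - 1) * (d%:Z - 1)) * \prod_(j < d + s) (t + j%:Z)%:~R.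

Definition yC (t : int) : 'rV[R]_d :=
  \row_(j < d) if j.+1 == d then pC t else t%:~R ^+ j.+1.

(* The index i : 'I_n is the 1-based index minus one. *)
Definition tC (i : 'I_n) : int := - s%:Z - d%:Z + i.+1%:Z.

Definition Cpolytope : set 'rV[R]_d := conv (fun i : 'I_n => yC (tC i)).

End MaximizerPolytope.

Arguments Cpolytope R d n s : clear implicits.

(* Main.v *)
Require Import Defs.
From mathcomp Require Import all_boot all_order all_algebra.
From mathcomp Require Import finmap.
From mathcomp Require Import boolp classical_sets functions cardinality reals.
(* Re-imported so that [setP], [subsetP], etc. denote the lemmas on finite sets. *)
From mathcomp Require Import fintype finset bigop.
From mathcomp Require Import zify ring lra.

(* Put the barycentre of the points at the origin and cone over the facets.
   Raising the heights of the points generically and infinitesimally refines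
   these cones to a complete simplicial fan which still contains the cone over
   every facet other than F.  For a generic vector w, every face T of the fan
   lies in exactly one maximal cone G in which the coordinates of w outside T
   are positive; hence the faces are partitioned into the intervals
   [neg_w(G), G], and h_k is the number of cones G with |neg_w(G)| = k, for
   any choice of w.  Choosing w close to a vertex v shows that the h-numbers of
   the link of v are at most those of the fan, and summing over v gives
   McMullen's recursion (k+1) h_(k+1) <= (n-d+k) h_k, whence the upper bound
   theorem for the fan.  Choosing w = -u, respectively w = u, with u in the
   cone over F partitions the faces of P', respectively the faces of P' not
   contained in F, so that h_k(P') and h_(d-k)(P') count the facets G <> F with
   |neg_(-u)(G)| = k and |neg_u(G)| = k.  The former is at most h_k of the fan.
   For the latter the recursion is
   (k+1) h_(d-k-1) + (d-k) h_(d-k) <= (d+s) h_(d-k) + (n-d-s) binom(n-d-1+k, k),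
   since a vertex outside F has the same link in P' and in the fan.
   In C(d,n,s), Gale's evenness condition, obtained from the positivity of
   divided differences, shows that all sets of at most (d-1)/2 vertices, and
   all sets of at most d/2 vertices not contained in F, are faces of P'.  Both
   families of bounds are therefore attained, and the face numbers, which are
   nonnegative combinations of the h-numbers, are compared term by term. *)

Set Implicit Arguments.
Unset Strict Implicit.
Unset Printing Implicit Defensive.
Import Order.TTheory GRing.Theory Num.Theory.

(** * Binomial identities *)

(** A shelling would order the facets; counting negative coordinates of a vector w needs no order,
    and the freedom to change w is what makes links comparable. That the intervals partition the
    faces is linear programming: the cones are the vertices of [{x | x <= c}], w is the objective,
    and the cone attached to T is the unique optimum on the face where T is tight. The obstacle is
    F, the only facet that need not be a simplex: nothing is known about how the perturbation
    subdivides it, so its pieces must not enter the counts. Taking w or -w in the cone over F is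
    what separates their intervals from the others. The term binom(s+k-1, k) solves the homogeneous
    recursion (k+1) x_(k+1) = (s+k) x_k with x_0 = 1, and so makes up for h_d(P') = 0. The ranges k
    <= (d-1)/2 and d-k with k <= d/2 together exhaust 0, ..., d. The factor (n-1)^((t-1)(d-1)) makes
    the heights outside F grow by more than (n-1)^(d-1) per node; this outweighs the ratio of two
    products of d-1 node differences, each difference lying between 1 and n-1. *)

Section Binomials.
Local Open Scope nat_scope.

Lemma bin_trinomial D e l : l <= e <= D ->
  'C(D, l) * 'C(D - l, e - l) = 'C(D, e) * 'C(e, l).
Proof.
move=> /andP[le1 le2].
have h1 := bin_fact (leq_trans le1 le2).
have h2 := bin_fact le2.
have h3 := bin_fact le1.
have h4 : 'C(D - l, e - l) * ((e - l)`! * (D - e)`!) = (D - l)`!.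
  by rewrite -[in RHS](bin_fact (leq_sub2r l le2)); congr (_ * (_ * _`!)); lia.
have p : 0 < l`! * (e - l)`! * (D - e)`! by rewrite !muln_gt0 !fact_gt0.
apply/eqP; rewrite -(eqn_pmul2r p); apply/eqP.
transitivity (D`!).
  by rewrite -[RHS]h1 -h4; ring.
by rewrite -[LHS]h2 -h3; ring.
Qed.

(** The h-vector binom(a+k-1, k) has the face numbers of a complex in which all sets of a+d points
    are faces. It is used with a = n-d and a = s; at k = 0 the truncated subtraction still gives the
    value 1. *)
Lemma bin_upper_convolution a d i : i <= d ->
  \sum_(k < d.+1) 'C(a + k - 1, k) * 'C(d - k, d - i) = 'C(a + d, i).
Proof.
elim: d a i => [|d IHd] a i.
  by rewrite leqn0 => /eqP->; rewrite big_ord1 !bin0.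
elim: a i => [|a IHa] [|i] lid.
- rewrite big_ord_recl big1 ?addn0 ?subn0 ?bin0 ?binn // => k _.
  by rewrite /= bin_small //= /bump; lia.
- rewrite big_ord_recl big1 => [|k _]; last by rewrite /= bin_small //= /bump; lia.
  by rewrite bin0 mul1n addn0 subn0 add0n bin_sub.
- rewrite big_ord_recl big1 ?addn0 ?subn0 ?bin0 ?binn // => k _.
  by rewrite /= [X in _ * X]bin_small ?muln0 // /bump; lia.
have o0 : nat_of_ord (@ord0 d.+1) = 0 by [].
rewrite addSn binS -IHa // !(big_ord_recl d.+1) !o0 !bin0 !mul1n -addnA.
congr (_ + _).
have {IHd} <- : \sum_(k < d.+1) 'C(a.+1 + k - 1, k) * 'C(d - k, d - i) = 'C(a + d.+1, i).
  by rewrite IHd //; congr binomial; lia.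
rewrite -big_split; apply: eq_bigr => k _; rewrite !lift0 /=.
have -> : a.+1 + k.+1 - 1 = (a + k).+1 by lia.
have -> : a + k.+1 - 1 = a + k by lia.
have -> : a.+1 + k - 1 = a + k by lia.
by rewrite binS !subSS mulnDl.
Qed.

(** The system is unitriangular, since binom(d-k, d-i) is 0 for k > i and 1 for k = i. Thus small
    faces alone determine the low h-numbers. *)
Lemma bin_triangular_inj d m (a b : nat -> nat) :
  (forall i, i <= m -> \sum_(k < d.+1) a k * 'C(d - k, d - i) =
                        \sum_(k < d.+1) b k * 'C(d - k, d - i)) ->
  m <= d -> forall k, k <= m -> a k = b k.
Proof.
move=> h md; elim/ltn_ind => k IH km.
have kd : k < d.+1 by lia.
have := h k km; rewrite (bigD1 (Ordinal kd)) //= [in RHS](bigD1 (Ordinal kd)) //=.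
rewrite binn !muln1.
rewrite (eq_bigr (fun i : 'I_d.+1 => b i * 'C(d - i, d - k))); first by move/addIn.
move=> i; rewrite -val_eqE /= => ik; have [lt|ge] := ltnP i k.
  by rewrite IH //; lia.
rewrite !bin_small ?muln0 //; have := ltn_ord i; lia.
Qed.

Local Open Scope ring_scope.

Lemma bin_inversion d (a : nat -> nat) k : (k <= d)%N ->
  \sum_(i < k.+1) (-1) ^+ (k - i) * 'C(d - i, k - i)%:Z *
     (\sum_(j < d.+1) a j * 'C(d - j, d - i))%N%:Z = (a k)%:Z.
Proof.
move=> kd.
transitivity (\sum_(j < d.+1) (a j)%:Z * \sum_(i < k.+1)
   (-1) ^+ (k - i) * 'C(d - i, k - i)%:Z * 'C(d - j, d - i)%:Z).
  rewrite (eq_bigr (fun i : 'I_k.+1 => \sum_(j < d.+1) (a j)%:Z * (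
   (-1) ^+ (k - i) * 'C(d - i, k - i)%:Z * 'C(d - j, d - i)%:Z))).
    by rewrite exchange_big; apply: eq_bigr => j _; rewrite mulr_sumr.
  move=> i _; rewrite -[Posz (\sum_(j < _) _)]natz natr_sum mulr_sumr.
  by apply: eq_bigr => j _; rewrite natrM !natz; ring.
have kd' : (k < d.+1)%N by lia.
rewrite (bigD1 (Ordinal kd')) //= [X in _ + X]big1 => [|j jk].
  rewrite addr0 big_ord_recr /= subnn expr0 bin0 binn big1 ?add0r ?mulr1 // => i _.
  by rewrite [X in _ * X%:Z]bin_small ?mulr0 //; have := ltn_ord i; rewrite /=; lia.
rewrite (_ : \sum_(i < k.+1) _ = 0) ?mulr0 //.
move: jk; rewrite -val_eqE /= => jk.
have [kj|jk'] := ltnP k j.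
  rewrite big1 // => i _; rewrite [X in _ * X%:Z]bin_small ?mulr0 //.
  by have := ltn_ord i; have := ltn_ord j; lia.
rewrite -(big_mkord predT (fun i => (-1) ^+ (k - i) * 'C(d - i, k - i)%:Z * 'C(d - j, d - i)%:Z)).
rewrite (@big_cat_nat _ _ _ j) //=; last by lia.
rewrite big_nat_cond big1 ?add0r => [|i /andP[ij _]]; last first.
  by rewrite [X in _ * X%:Z]bin_small ?mulr0 //; have := ltn_ord j; lia.
rewrite -{1}(add0n j) big_addn big_mkord.
have -> : (k.+1 - j = (k - j).+1)%N by lia.
(* The trinomial identity pulls binom(d-j, k-j) out of the sum and leaves the expansion of
   (-1+1)^(k-j), which is zero because j < k. *)
transitivity ('C(d - j, k - j)%:Z * (-1 + 1) ^+ (k - j)); last first.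
  by rewrite addNr expr0n (_ : (k - j == 0)%N = false) ?mulr0 //; lia.
rewrite exprDn mulr_sumr; apply: eq_bigr => l _.
have le : (l <= k - j <= d - j)%N by have := ltn_ord l; lia.
have := bin_trinomial le; rewrite expr1n mulr1 => /(congr1 Posz).
rewrite !PoszM => E.
have -> : (d - (l + j) = d - j - l)%N by lia.
have -> : (k - (l + j) = k - j - l)%N by lia.
rewrite bin_sub; last by lia.
rewrite -mulrA [X in _ * X]mulrC E -mulr_natr natz.
by ring.
Qed.

End Binomials.

(** * Interval partitions and h-numbers *)

Section IntervalPartition.
Local Open Scope nat_scope.
Variables (n d : nat).
Implicit Types (K Phi : {set {set 'I_n}}) (r : {set 'I_n} -> {set 'I_n}).

(** A partitioning of a pure complex with restriction map [r], as a shelling would produce. [Phi] is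
    not assumed closed under subsets, so that the relative complex [faces_off] is covered too. *)
Definition interval_partition K r Phi :=
  [/\ forall G, G \in K -> #|G| = d /\ r G \subset G,
      forall T : {set 'I_n}, T \in Phi -> exists G, [/\ G \in K, r G \subset T & T \subset G],
      forall G G' (T : {set 'I_n}), G \in K -> G' \in K -> r G \subset T -> T \subset G ->
        r G' \subset T -> T \subset G' -> G = G'
    & forall G (T : {set 'I_n}), G \in K -> r G \subset T -> T \subset G -> T \in Phi].

Definition hcount K r k := #|[set G in K | #|r G| == k]|.
Definition fcount Phi i := #|[set T in Phi | #|T| == i]|.

Lemma card_interval (A G : {set 'I_n}) i : A \subset G -> i <= #|G| ->
  #|[set T : {set 'I_n} | [&& A \subset T, T \subset G & #|T| == i]]| =
    'C(#|G| - #|A|, #|G| - i).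
Proof.
move=> AG iG.
have K (T : {set 'I_n}) : T \subset G -> G :\: (G :\: T) = T.
  by move=> TG; rewrite setDDr setDv set0U; apply/setIidPr.
rewrite -(card_in_imset (f := fun T => G :\: T)); last first.
  move=> T T'; rewrite !inE => /and3P[_ TG _] /and3P[_ TG' _] E.
  by rewrite -(K _ TG) E K.
have <- : #|G :\: A| = #|G| - #|A| by rewrite cardsD (setIidPr AG).
rewrite -cards_draws; apply: eq_card => U; rewrite !inE.
apply/imsetP/andP => [[T]|[UG cU]].
  rewrite inE => /and3P[AT TG /eqP cT] ->.
  by rewrite setDS // cardsD (setIidPr TG) cT.
have UG' : U \subset G by apply: subset_trans UG (subsetDl _ _).
exists (G :\: U); last by rewrite K.
rewrite inE subsetDl cardsD (setIidPr UG') (eqP cU) subKn // eqxx !andbT.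
rewrite subsetD AG /= -setI_eq0; apply/eqP/setP => x; rewrite !inE.
apply/negP => /andP[xA xU]; move/subsetP/(_ x xU): UG.
by rewrite !inE xA.
Qed.

Section Fixed.
Variables (K Phi : {set {set 'I_n}}) (r : {set 'I_n} -> {set 'I_n}).
Hypothesis KP : interval_partition K r Phi.

(** Each set of [Phi] lies in exactly one interval [r G, G], and this interval has binom(d-|r G|,
    d-i) members of size i. *)
Lemma fcount_hcount i : i <= d ->
  fcount Phi i = \sum_(k < d.+1) hcount K r k * 'C(d - k, d - i).
Proof.
case: KP => Kr Phi_ex Phi_un PhiI id.
transitivity (\sum_(G in K) 'C(d - #|r G|, d - i)).
  rewrite /fcount -sum1_card.
  transitivity (\sum_(T in [set T in Phi | #|T| == i])
                 \sum_(G in K | (r G \subset T) && (T \subset G)) 1).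
    apply: eq_bigr => T; rewrite inE => /andP[TP _].
    have [G [GK rGT TG]] := Phi_ex T TP.
    rewrite (bigD1 G) /= ?GK ?rGT // big1 // => G' /andP[/and3P[GK' rGT' TG']].
    by rewrite (Phi_un G' G T) ?eqxx.
  rewrite (exchange_big_dep (mem K)) /=; last by move=> T G _ /andP[].
  apply: eq_bigr => G GK; have [cG rG] := Kr G GK.
  rewrite sum1dep_card -[in RHS]cG -card_interval //; last by rewrite cG.
  apply: eq_card => T; rewrite !inE GK /=.
  case rT : (r G \subset T); rewrite ?andbF //=.
  case TG : (T \subset G); rewrite ?andbF //= andbT.
  by rewrite (PhiI G T).
rewrite (partition_big (fun G => inord #|r G| : 'I_d.+1) predT) //=.
apply: eq_bigr => k _; rewrite /hcount -sum1_card big_distrl /=.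
apply: eq_big => [G|G /andP[GK /eqP <-]].
  rewrite inE; case GK : (G \in K) => //=; have [cG rG] := Kr G GK.
  by rewrite -val_eqE /= inordK // ltnS -cG subset_leq_card.
by have [cG rG] := Kr G GK; rewrite mul1n inordK // ltnS -cG subset_leq_card.
Qed.

Lemma hcount_gt k : d < k -> hcount K r k = 0.
Proof.
case: KP => Kr _ _ _ dk; apply/eqP; rewrite cards_eq0; apply/eqP/setP => G.
rewrite !inE; apply/negP => /andP[/Kr[cG /subset_leq_card]].
by rewrite cG => rd /eqP rk; move: rd; rewrite rk leqNgt dk.
Qed.

(* The link of [v] is represented by the faces containing [v], so that its h_k
   is counted by [hcount] at [k.+1]. *)
Definition link_facets v := [set G in K | v \in G].
Definition link_faces v := [set T in Phi | v \in T].
Definition link_restr v G := v |: r G.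

Lemma interval_partition_link v :
  interval_partition (link_facets v) (link_restr v) (link_faces v).
Proof.
case: KP => Kr Phi_ex Phi_un PhiI; split.
- move=> G; rewrite inE => /andP[/Kr[cG rG] vG]; split=> //.
  by rewrite subUset sub1set vG.
- move=> T; rewrite inE => /andP[/Phi_ex[G [GK rG TG]] vT].
  by exists G; rewrite inE GK (subsetP TG) // subUset sub1set vT.
- move=> G G' T; rewrite !inE => /andP[GK _] /andP[GK' _].
  rewrite !subUset => /andP[_ h1] h2 /andP[_ h3] h4.
  exact: (Phi_un G G' T).
- move=> G T; rewrite !inE subUset sub1set => /andP[GK _] /andP[-> h] TG.
  by rewrite (PhiI G).
Qed.

(** Count the pairs (v, G) with v in G. Adding v to r G yields k+1 elements either when v is one of
    k+1 elements of r G, or when |r G| = k and v is one of the d-k remaining elements of G. *)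
Lemma sum_hcount_link k :
  \sum_v hcount (link_facets v) (link_restr v) k.+1 =
    k.+1 * hcount K r k.+1 + (d - k) * hcount K r k.
Proof.
case: KP => Kr _ _ _.
transitivity (\sum_(G in K) #|[set v in G | #|v |: r G| == k.+1]|).
  transitivity (\sum_v \sum_(G in K | (v \in G) && (#|v |: r G| == k.+1)) 1).
    apply: eq_bigr => v _; rewrite sum1dep_card; apply: eq_card => G.
    by rewrite !inE andbA.
  rewrite (exchange_big_dep (mem K)) /=; last by move=> v G _ /andP[].
  apply: eq_bigr => G GK; rewrite sum1dep_card; apply: eq_card => v.
  by rewrite !inE GK.
rewrite /hcount -!sum1_card !big_distrr /= !muln1.
rewrite [X in X + _](eq_bigl (fun G => (G \in K) && (#|r G| == k.+1))); last first.
  by move=> G; rewrite inE.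
rewrite [X in _ + X](eq_bigl (fun G => (G \in K) && (#|r G| == k))); last first.
  by move=> G; rewrite inE.
rewrite !big_mkcondr -big_split /=; apply: eq_bigr => G /Kr[cG rG].
have cU v : #|v |: r G| = (v \notin r G) + #|r G| by rewrite cardsU1.
have [rk|rk] := eqVneq #|r G| k.+1.
  rewrite ifN; last by rewrite rk; lia.
  rewrite addn0 -rk; apply: eq_card => v; rewrite inE cU rk.
  have [vr|vr] := boolP (v \in r G); first by rewrite (subsetP rG) //= eqxx.
  by rewrite andbC; apply/negP => /andP[]; lia.
have [rk'|rk'] := eqVneq #|r G| k.
  rewrite add0n -cG -rk' -[in RHS](setIidPr rG) -cardsD; apply: eq_card => v.
  rewrite !inE cU rk'; case: (v \in r G) => /=; first by rewrite andbC; apply/negP => /andP[]; lia.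
  by rewrite add1n eqxx andbT.
apply/eqP; rewrite cards_eq0; apply/eqP/setP => v; rewrite !inE cU.
by apply/negP => /andP[_]; move: rk rk'; case: (v \in r G) => /=; lia.
Qed.

End Fixed.

(** The face numbers of [Phi] determine the counts. This permits a different weight vector for every
    vertex. *)
Lemma hcount_unique K K' r r' Phi k :
  interval_partition K r Phi -> interval_partition K' r' Phi ->
  hcount K r k = hcount K' r' k.
Proof.
move=> KP KP'; have [kd|dk] := leqP k d; last first.
  by rewrite (hcount_gt KP) // (hcount_gt KP').
apply: (bin_triangular_inj (d := d) (m := d)) => // i id.
by rewrite -(fcount_hcount KP) // -(fcount_hcount KP').
Qed.

Lemma hcount_link_le K r v k :
  (forall G, G \in K -> v \in G -> v \notin r G) ->
  hcount (link_facets K v) (link_restr r v) k.+1 <= hcount K r k.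
Proof.
move=> vr; apply/subset_leq_card/subsetP => G; rewrite !inE => /andP[/andP[GK vG]].
by rewrite GK /= cardsU1 (vr _ GK vG) add1n.
Qed.

End IntervalPartition.

(** * Upper bounds from the link recursions *)

Section HBounds.
Local Open Scope nat_scope.
Variables (d n : nat).
Hypothesis dn : d < n.

(** The recursion amounts to (k+1) h_(k+1) <= (n-d+k) h_k, which the binomials on the right satisfy
    with equality. *)
Lemma h_bound (h : nat -> nat) : h 0 <= 1 ->
  (forall k, k < d -> k.+1 * h k.+1 + (d - k) * h k <= n * h k) ->
  forall k, k <= d -> h k <= 'C(n - d - 1 + k, k).
Proof.
move=> h0 hS; elim=> [|k IH] kd; first by rewrite bin0.
have {}IH := IH (ltnW kd); have {}hS := hS k kd.
rewrite -(@leq_pmul2l k.+1) // addnS -mul_bin_diag /=.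
have : (n - d - 1 + k).+1 * h k <= (n - d - 1 + k).+1 * 'C(n - d - 1 + k, k).
  by rewrite leq_mul2l IH orbT.
have -> : (n - d - 1 + k).+1 = n - (d - k) by lia.
by rewrite mulnBl; lia.
Qed.

(** Adding binom(s+k-1, k) to [h] raises the initial value from 0 to 1 and turns the recursion into
    that of the right-hand binomials, because (s+k) + (n-d-s) = n-d+k. *)
Lemma h_bound_relative s (h : nat -> nat) : d + s < n -> h 0 = 0 ->
  (forall k, k < d -> k.+1 * h k.+1 + (d - k) * h k <=
     (d + s) * h k + (n - d - s) * 'C(n - d - 1 + k, k)) ->
  forall k, k <= d -> h k + 'C(s + k - 1, k) <= 'C(n - d - 1 + k, k).
Proof.
move=> dsn h0 hS; elim=> [|k IH] kd; first by rewrite h0 !bin0.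
have {}IH := IH (ltnW kd); have {}hS := hS k kd.
rewrite -(@leq_pmul2l k.+1) // [n - d - 1 + k.+1]addnS -mul_bin_diag /= mulnDr.
have -> : s + k.+1 - 1 = s + k by lia.
rewrite -mul_bin_diag.
have -> : (s + k).-1 = s + k - 1 by lia.
have : (s + k) * (h k + 'C(s + k - 1, k)) <= (s + k) * 'C(n - d - 1 + k, k).
  by rewrite leq_mul2l IH orbT.
have -> : (n - d - 1 + k).+1 = (s + k) + (n - d - s) by lia.
rewrite mulnDr mulnDl => h1.
have e : (d + s) * h k = (d - k) * h k + (s + k) * h k by rewrite -mulnDl; congr (_ * _); lia.
by rewrite e in hS; lia.
Qed.

End HBounds.

(** * Infinitesimal perturbations *)

Section SmallParameter.
Local Open Scope ring_scope.
Variable R : realFieldType.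
Implicit Types p q : {poly R}.

Lemma horner_bounded p :
  exists2 M, 0 <= M & forall e : R, 0 < e < 1 -> `|p.[e]| <= M.
Proof.
elim/poly_ind: p => [|p c [M M0 hM]].
  by exists 0 => // e _; rewrite horner0 normr0.
exists (M + `|c|) => [|e e01]; first by rewrite addr_ge0.
rewrite !hornerE (le_trans (ler_normD _ _)) // lerD2r normrM.
case/andP: (e01) => e0 e1; rewrite (gtr0_norm e0).
by apply: le_trans (hM e e01); rewrite ler_piMr // ltW.
Qed.

(** [sigma] is the sign of the lowest nonzero coefficient, which dominates just to the right of
    0. *)
Lemma sgr_horner_right p :
  exists2 sigma : R, (p != 0 -> sigma != 0) /\ (p.[0] != 0 -> sigma = Num.sg p.[0]) &
    exists2 delta, 0 < delta & forall e : R, 0 < e < delta -> Num.sg p.[e] = sigma.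
Proof.
elim/poly_ind: p => [|p c [sigma [p0 _] [delta delta0 hp]]].
  by exists 0; [split; rewrite ?horner0 eqxx | exists 1 => // e _; rewrite horner0 sgr0].
have [->|c0] := eqVneq c 0.
  exists sigma; last first.
    exists delta => // e /andP[e0 ed]; rewrite addr0 hornerM hornerX sgrM hp ?e0 //.
    by rewrite (gtr0_sg e0) mulr1.
  rewrite addr0 hornerM hornerX mulr0 eqxx; split=> // h; apply: p0.
  by apply: contraNneq h => ->; rewrite mul0r.
have [M M0 hM] := horner_bounded p.
exists (Num.sg c); first by rewrite sgr_eq0 c0 hornerD hornerM hornerX hornerC mulr0 add0r.
exists (Num.min 1 (`|c| / (M + 1))).
  by rewrite lt_min ltr01 divr_gt0 ?normr_gt0 // ltr_wpDl.
move=> e /andP[e0]; rewrite lt_min => /andP[e1 ec].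
have {}hM : `|p.[e] * e| < `|c|.
  rewrite normrM (gtr0_norm e0); apply: le_lt_trans (_ : (M + 1) * e < _).
    by rewrite ler_wpM2r ?ltW //; have := hM e; rewrite e0 e1 => /(_ isT); lra.
  by rewrite mulrC -ltr_pdivlMr // ltr_wpDl.
rewrite !hornerE; have [cp|cn|cz] := ltrgt0P c; last by rewrite cz eqxx in c0.
  rewrite (gtr0_sg cp); apply: gtr0_sg; rewrite (gtr0_norm cp) ltr_norml in hM; lra.
by rewrite (ltr0_sg cn); apply: ltr0_sg; rewrite (ltr0_norm cn) ltr_norml in hM; lra.
Qed.

(** One real [e] acts as an infinitesimal for finitely many genericity conditions at once. *)
Lemma small_parameter (ps : seq {poly R}) : exists2 e : R, 0 < e &
  forall p, p \in ps -> (p != 0 -> p.[e] != 0) /\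
    (p.[0] != 0 -> Num.sg p.[e] = Num.sg p.[0]).
Proof.
suff [delta delta0 h] : exists2 delta : R, 0 < delta & forall e, 0 < e < delta ->
    forall p, p \in ps -> (p != 0 -> p.[e] != 0) /\
      (p.[0] != 0 -> Num.sg p.[e] = Num.sg p.[0]).
  by exists (delta / 2); [rewrite divr_gt0 | apply: h; lra].
elim: ps => [|p ps [delta delta0 IH]]; first by exists 1.
have [sigma [s1 s2] [delta' delta'0 hp]] := sgr_horner_right p.
exists (Num.min delta delta') => [|e]; first by rewrite lt_min delta0.
rewrite lt_min => /and3P[e0 ed ed'] q; rewrite inE => /orP[/eqP->|].
  have {}hp := hp e; rewrite e0 ed' in hp; have {}hp := hp isT.
  by split=> [/s1|/s2 <-] //; rewrite -hp sgr_eq0.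
by apply: IH; rewrite e0.
Qed.

End SmallParameter.

(** * Simplicial fans *)

Section ValueSpace.
Local Open Scope ring_scope.
Variables (R : realFieldType) (m n : nat) (N : 'M[R]_(m, n)).
Local Notation d := (\rank N).
Implicit Types (x y c nu : 'rV[R]_n) (G T Z : {set 'I_n}).

(* A functional [a] on the span of [v_1, ..., v_n] is represented by its value
   vector [(a v_1, ..., a v_n)]; the row space of [N] consists of all of these. *)
Definition full T : Prop :=
  forall x, (x <= N)%MS -> (forall i, i \in T -> x 0 i = 0) -> x = 0.

(** [full] says that the vectors $v_i$ span, since only the zero functional vanishes on them all;
    with d elements they form a basis. *)
Definition basis G : Prop := full G /\ #|G| = d.

Lemma full_sub T T' : T \subset T' -> full T -> full T'.
Proof. by move=> /subsetP TT' fT x xN x0; apply: fT => // i /TT'; apply: x0. Qed.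

Lemma full_eq T x y : full T -> (x <= N)%MS -> (y <= N)%MS ->
  (forall i, i \in T -> x 0 i = y 0 i) -> x = y.
Proof.
move=> fT xN yN xy; apply/eqP; rewrite -subr_eq0; apply/eqP; apply: fT.
  by rewrite addmx_sub // eqmx_opp.
by move=> i /xy E; rewrite !mxE E subrr.
Qed.

Definition restr_base T : 'M[R]_(d, #|T|) := colsub enum_val (row_base N).

Lemma restr_base_free T : full T -> row_free (restr_base T).
Proof.
move=> fT; apply: inj_row_free => a a0.
have E : a *m row_base N = 0.
  apply: fT; first by apply: submx_trans (submxMl _ _) _; rewrite eq_row_base.
  move=> i iT; move/matrixP/(_ 0 (enum_rank_in iT i)): a0; rewrite !mxE => a0; rewrite -[RHS]a0.
  by apply: eq_bigr => k _; rewrite [restr_base _ _ _]mxE enum_rankK_in.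
have := row_base_free N; rewrite -kermx_eq0 => /eqP K.
by apply/eqP; rewrite -submx0 -K; apply/sub_kermxP.
Qed.

Lemma full_card T : full T -> (d <= #|T|)%N.
Proof. by move/restr_base_free/eqP => <-; exact: rank_leq_col. Qed.

Lemma full_basis T : full T -> exists2 G, basis G & G \subset T.
Proof.
move=> fT.
have fA : row_full (restr_base T)^T.
  by rewrite /row_full mxrank_tr; exact: restr_base_free.
pose f k := enum_val (fullrankfun fA k).
have f_inj : injective f by move=> k l /enum_val_inj/fullrankfun_inj.
exists [set f k | k : 'I_d]; last by apply/subsetP => _ /imsetP[k _ ->]; exact: enum_valP.
split; last by rewrite card_imset // card_ord.
move=> x; rewrite -(eq_row_base N) => /submxP[a ->] x0.
suff -> : a = 0 by rewrite mul0mx.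
have := fullrowsub_unit fA; rewrite -unitmx_tr => U.
rewrite -(mulmxK U a) (_ : a *m _ = 0) ?mul0mx //.
apply/rowP => k; rewrite [RHS]mxE -(x0 (f k)) ?imset_f // !mxE.
by apply: eq_bigr => l _; rewrite !mxE.
Qed.

Lemma basis_ex G c : basis G ->
  exists x, (x <= N)%MS /\ forall i, i \in G -> x 0 i = c 0 i.
Proof.
move=> [/restr_base_free fG cG].
have /submx_full sub : row_full (restr_base G) by rewrite /row_full (eqP fG) cG.
have /submxP [a E] := sub _ (colsub enum_val c).
exists (a *m row_base N); split.
  by apply: submx_trans (submxMl _ _) _; rewrite eq_row_base.
move=> i iG; move/matrixP/(_ 0 (enum_rank_in iG i)): E; rewrite !mxE enum_rankK_in // => ->.
by apply: eq_bigr => k _; rewrite [restr_base _ _ _]mxE enum_rankK_in.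
Qed.

(** For a basis [G] this is the linear function interpolating the heights [c] on the cone over [G],
    the candidate vertex of [{x | x <= c}] with tight set [G]. The default 0 is met only when no
    interpolation exists. *)
Definition ext G c : 'rV[R]_n :=
  xget 0 [set x | (x <= N)%MS /\ forall i, i \in G -> x 0 i = c 0 i]%classic.

Lemma extP G c : basis G ->
  (ext G c <= N)%MS /\ forall i, i \in G -> ext G c 0 i = c 0 i.
Proof.
by move=> bG; case: (basis_ex c bG) => x xP; rewrite /ext; case: xgetP => [y -> //|/(_ x)].
Qed.

Lemma ext_sub G c : basis G -> (ext G c <= N)%MS. Proof. by case/(extP c). Qed.
Lemma extE G c i : basis G -> i \in G -> ext G c 0 i = c 0 i.
Proof. by case/(extP c) => _; apply. Qed.
Lemma ext_eq G c x : basis G -> (x <= N)%MS ->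
  (forall i, i \in G -> x 0 i = c 0 i) -> x = ext G c.
Proof.
move=> bG xN xc; apply: (full_eq (proj1 bG)) => // [|i iG]; first exact: ext_sub.
by rewrite xc // extE.
Qed.

Definition dual G j : 'rV[R]_n := ext G (delta_mx 0 j).

Lemma dual_sub G j : basis G -> (dual G j <= N)%MS. Proof. exact: ext_sub. Qed.
Lemma dualE G j i : basis G -> i \in G -> dual G j 0 i = (i == j)%:R.
Proof. by move=> bG iG; rewrite extE // mxE. Qed.

Lemma dual_expand G x : basis G -> (x <= N)%MS ->
  x = \sum_(j in G) x 0 j *: dual G j.
Proof.
move=> bG xN; apply: (full_eq (proj1 bG)) => // [|i iG].
  by apply: summx_sub => j _; rewrite scalemx_sub // dual_sub.
rewrite summxE (bigD1 i) //= mxE dualE // eqxx mulr1 big1 ?addr0 // => j /andP[_ ji].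
by rewrite mxE dualE // eq_sym (negPf ji) mulr0.
Qed.

(* [pair nu] is evaluation at the vector [w = \sum_i nu_i v_i], and
   [coef nu G j] below is the coordinate of [w] at [v_j] in the basis [G]. *)
Definition pair nu x : R := \sum_i nu 0 i * x 0 i.

Lemma pairD nu x y : pair nu (x + y) = pair nu x + pair nu y.
Proof. by rewrite -big_split; apply: eq_bigr => i _; rewrite mxE mulrDr. Qed.
Lemma pairN nu x : pair nu (- x) = - pair nu x.
Proof. by rewrite -sumrN; apply: eq_bigr => i _; rewrite mxE mulrN. Qed.
Lemma pairNl nu x : pair (- nu) x = - pair nu x.
Proof. by rewrite -sumrN; apply: eq_bigr => i _; rewrite mxE mulNr. Qed.
Lemma pairZ nu a x : pair nu (a *: x) = a * pair nu x.
Proof. by rewrite mulr_sumr; apply: eq_bigr => i _; rewrite mxE; ring. Qed.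

Definition coef nu G j := pair nu (dual G j).

Lemma pair_coef nu G x : basis G -> (x <= N)%MS ->
  pair nu x = \sum_(j in G) x 0 j * coef nu G j.
Proof.
move=> bG xN; rewrite {1}(dual_expand bG xN).
rewrite (big_morph (pair nu) (pairD nu) (_ : pair nu 0 = 0)).
  by apply: eq_bigr => j _; rewrite pairZ.
by rewrite /pair big1 // => i _; rewrite mxE mulr0.
Qed.

Definition neg nu G := [set j in G | coef nu G j < 0].

Definition generic_weight nu :=
  forall G j, basis G -> j \in G -> coef nu G j != 0.

Lemma generic_weight_opp nu : generic_weight nu -> generic_weight (- nu).
Proof. by move=> gnu G j bG jG; rewrite /coef pairNl oppr_eq0; apply: gnu. Qed.

Lemma coef_gt0 nu G T j : generic_weight nu -> basis G -> neg nu G \subset T ->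
  j \in G -> j \notin T -> 0 < coef nu G j.
Proof.
move=> gnu bG /subsetP nT jG jT; rewrite lt_neqAle eq_sym gnu //= leNgt.
by apply: contra jT => h; apply: nT; rewrite inE jG.
Qed.

(** Weak duality with complementary slackness: wherever [a] may be nonzero on [G], the coordinate of
    w is positive. *)
Lemma sum_coef_ge0 nu G T (a : 'I_n -> R) : generic_weight nu -> basis G ->
  neg nu G \subset T -> (forall j, j \in G -> j \in T -> a j = 0) ->
  (forall j, j \in G -> 0 <= a j) ->
  0 <= \sum_(j in G) a j * coef nu G j ?= iff [forall j in G, a j == 0].
Proof.
move=> gnu bG nT aT a0.
have t0 j : j \in G -> 0 <= a j * coef nu G j.
  move=> jG; case: (boolP (j \in T)) => jT; first by rewrite aT ?mul0r.
  by rewrite mulr_ge0 ?a0 // ltW // (coef_gt0 _ _ nT).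
split; first exact: sumr_ge0.
rewrite eq_sym psumr_eq0 //; apply/allP/forallP => [h j|h j _].
  apply/implyP => jG; case: (boolP (j \in T)) => jT; first by rewrite aT.
  move: (h j (mem_index_enum _)); rewrite jG /= mulf_eq0 => /orP[//|].
  by rewrite (negPf (gnu _ _ bG jG)).
by apply/implyP => jG; move: (h j); rewrite jG => /eqP ->; rewrite mul0r.
Qed.

Definition generic_height c :=
  forall G i, basis G -> i \notin G -> ext G c 0 i != c 0 i.

(* The maximal cones of the fan correspond to the vertices of the polyhedron
   [{x | x <= c}], each given by its set of tight constraints. *)
Definition fan c : {set {set 'I_n}} :=
  [set G | `[< basis G /\ forall i, i \notin G -> ext G c 0 i < c 0 i >]].

Lemma fanP c G : reflect (basis G /\ forall i, i \notin G -> ext G c 0 i < c 0 i)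
  (G \in fan c).
Proof. by rewrite inE; apply: asboolP. Qed.

Lemma fan_basis c G : G \in fan c -> basis G. Proof. by case/fanP. Qed.

Lemma ext_le c G i : G \in fan c -> ext G c 0 i <= c 0 i.
Proof.
case/fanP=> bG h; case: (boolP (i \in G)) => iG; first by rewrite extE.
by rewrite ltW // h.
Qed.

(** [ext G c] is the unique maximiser of [pair nu] on the face where [T] is tight: its difference
    with another vertex of that face vanishes on [T], is nonnegative on [G], and is positive at an
    element of [G] outside [G']. *)
Lemma fan_pair_lt c nu G G' T : generic_weight nu ->
  G \in fan c -> G' \in fan c -> T \subset G' -> neg nu G \subset T -> G != G' ->
  pair nu (ext G' c) < pair nu (ext G c).
Proof.
move=> gnu GF G'F TG' nT GG'.
have bG := fan_basis GF; have [[fG' cG'] hG'] := fanP _ _ G'F.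
rewrite -subr_gt0 -pairN -pairD (pair_coef _ bG); last first.
  by rewrite addmx_sub ?ext_sub // eqmx_opp ext_sub.
have [i iG iG'] : exists2 i, i \in G & i \notin G'.
  apply/subsetPn; apply: contra GG' => GG'; rewrite eqEcard GG' cG'.
  by rewrite (proj2 bG) leqnn.
rewrite lt_neqAle.
have [|j jG|h1 ->] := @sum_coef_ge0 nu G T
  (fun j => (ext G c - ext G' c) 0 j) gnu bG nT.
- move=> j jG jT; rewrite !mxE !extE ?subrr // (subsetP TG') //.
- by rewrite !mxE extE // subr_ge0 ext_le.
rewrite h1 andbT; apply/negP => /forallP/(_ i); rewrite iG /= !mxE extE // subr_eq0.
by rewrite gt_eqF // hG'.
Qed.

Lemma fan_unique c nu G G' T : generic_weight nu ->
  G \in fan c -> G' \in fan c -> neg nu G \subset T -> T \subset G ->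
  neg nu G' \subset T -> T \subset G' -> G = G'.
Proof.
move=> gnu GF G'F nG TG nG' TG'; apply/eqP; apply: contraT => GG'.
have := fan_pair_lt gnu GF G'F TG' nG GG'.
by rewrite ltNge ltW // (fan_pair_lt gnu G'F GF TG nG') // eq_sym.
Qed.

Hypothesis sumN : forall x, (x <= N)%MS -> \sum_i x 0 i = 0.

(** The vectors $v_i$ sum to zero, so a nowhere positive functional vanishes. Hence [{x | x <= c}]
    is bounded, which is the completeness of the fan. *)
Lemma exists_pos (e : 'rV[R]_n) : (e <= N)%MS -> e != 0 -> exists i, 0 < e 0 i.
Proof.
move=> eN e0; apply/existsP; apply: contraT; rewrite negb_exists => /forallP h.
have : \sum_i - e 0 i == 0 by rewrite sumrN sumN // oppr0.
rewrite psumr_eq0 => [/allP z|i _]; last by rewrite oppr_ge0 leNgt h.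
case/eqP: e0; apply/rowP => i; rewrite mxE; apply/eqP.
by rewrite -oppr_eq0; apply: z; rewrite mem_index_enum.
Qed.

Lemma ratio_test c x (e : 'rV[R]_n) : (e <= N)%MS -> e != 0 -> (forall i, x 0 i <= c 0 i) ->
  (forall i, 0 < e 0 i -> x 0 i < c 0 i) ->
  exists t i0, [/\ 0 < t, 0 < e 0 i0, (x + t *: e) 0 i0 = c 0 i0 &
    forall i, (x + t *: e) 0 i <= c 0 i].
Proof.
move=> eN e0 xc xlt; have [i1 i1p] := exists_pos eN e0.
pose q i := (c 0 i - x 0 i) / e 0 i.
case: (@arg_minP _ _ _ i1 (fun i => 0 < e 0 i) q i1p) => i0 i0p imin.
have t0 : 0 < q i0 by rewrite divr_gt0 // subr_gt0 xlt.
exists (q i0), i0; split=> // [|i].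
  by rewrite 2!mxE /q divfK ?lt0r_neq0 // addrC subrK.
rewrite !mxE; have [ei|ei] := ltrP 0 (e 0 i).
  by have := imin i ei; rewrite [X in _ <= X]/q ler_pdivlMr //; lra.
by have := xc i; have : q i0 * e 0 i <= 0 by [rewrite mulr_ge0_le0 // ltW]; lra.
Qed.

(* Simplex pivot: the linear program of maximising [pair nu] over
   [{y <= c}], restricted to the face [T] of the feasible polyhedron. *)
Lemma fan_pivot c nu G T j : generic_height c -> generic_weight nu ->
  G \in fan c -> T \subset G -> j \in neg nu G -> j \notin T ->
  exists G', [/\ G' \in fan c, T \subset G' &
    pair nu (ext G c) < pair nu (ext G' c)].
Proof.
move=> gc gnu GF TG; rewrite inE => /andP[jG cj] jT.
have [bG hG] := fanP _ _ GF.
(* Moving along [- dual G j] releases the constraint [j] alone, keeps the others of [G] tight, and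
   raises [pair nu] because [coef nu G j] is negative. *)
set x := ext G c; pose e := - dual G j.
have eN : (e <= N)%MS by rewrite eqmx_opp dual_sub.
have ej : e 0 j = -1 by rewrite mxE dualE // eqxx.
have eG i : i \in G -> i != j -> e 0 i = 0.
  by move=> iG ij; rewrite mxE dualE // (negPf ij) oppr0.
have e0 : e != 0.
  by apply/eqP => /rowP/(_ j); rewrite ej mxE => /eqP; rewrite oppr_eq0 oner_eq0.
have epG i : 0 < e 0 i -> i \notin G.
  move=> ei; apply/negP => iG; case: (eqVneq i j) ei => [->|ij]; first by rewrite ej ltr0N1.
  by rewrite eG // ltxx.
have [|i ei|t [i0 [t0 i0p yc0 yle]]] := @ratio_test c x e eN e0.
- by move=> i; exact: ext_le.
- by rewrite hG // epG.
pose y := x + t *: e; rewrite -/y in yc0 yle.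
have yN : (y <= N)%MS by rewrite addmx_sub ?ext_sub // scalemx_sub.
pose G' := i0 |: (G :\ j).
have i0G := epG i0 i0p.
have bG' : basis G'.
  split; last by rewrite cardsU1 !inE (negPf i0G) andbF /= -(proj2 bG) (cardsD1 j G) jG.
  move=> z zN z0.
  have zE : z = z 0 j *: dual G j.
    rewrite {1}(dual_expand bG zN) (bigD1 j) //= big1 ?addr0 // => i /andP[iG ij].
    by rewrite z0 ?scale0r // !inE ij iG orbT.
  have : z 0 i0 = 0 by apply: z0; rewrite !inE eqxx.
  rewrite {1}zE mxE => /eqP; rewrite mulf_eq0 => /orP[/eqP zj|/eqP zi].
    by rewrite zE zj scale0r.
  by move: i0p; rewrite mxE zi oppr0 ltxx.
have yc i : i \in G' -> y 0 i = c 0 i.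
  rewrite !inE => /orP[/eqP-> //|/andP[ij iG]].
  by rewrite mxE [X in _ + X]mxE eG // mulr0 addr0 extE.
have yE : y = ext G' c by apply: ext_eq.
exists G'; split.
(* Generic heights exclude any further tight constraint at the new vertex. *)
- apply/fanP; split=> // i iG'.
  by rewrite lt_neqAle gc //= -yE yle.
- apply/subsetP => i iT; rewrite !inE (subsetP TG) // andbT.
  by apply/orP; right; apply: contraNneq jT => <-.
by rewrite -yE pairD pairZ ltrDl mulr_gt0 // pairN oppr_gt0.
Qed.

(** Termination of the simplex method is replaced by a maximum over the finite fan: a cone
    maximising [pair nu] admits no pivot, so its negative coordinates all lie in [T]. *)
Lemma fan_cover c nu G0 T : generic_height c -> generic_weight nu ->
  G0 \in fan c -> T \subset G0 ->
  exists G, [/\ G \in fan c, neg nu G \subset T & T \subset G].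
Proof.
move=> gc gnu G0F TG0.
have P0 : (G0 \in fan c) && (T \subset G0) by rewrite G0F.
case: (@arg_maxP _ _ _ G0 (fun G => (G \in fan c) && (T \subset G))
  (fun G => pair nu (ext G c)) P0) => G /andP[GF TG] Gmax.
exists G; split=> //; apply/subsetP => j jn; apply: contraT => jT.
have [G' [G'F TG' lt]] := fan_pivot gc gnu GF TG jn jT.
by have := Gmax G'; rewrite G'F TG' => /(_ isT); rewrite /= leNgt lt.
Qed.

End ValueSpace.

(** * Almost simplicial configurations *)

Section Configuration.
Local Open Scope ring_scope.
Variables (R : realFieldType) (m n : nat) (N : 'M[R]_(m, n)).
Local Notation d := (\rank N).
Implicit Types (x y c nu : 'rV[R]_n) (F G T Z : {set 'I_n}).

(** A point of the polar dual. The origin being the barycentre, a proper face is cut out by a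
    functional normalised to 1 on it. *)
Definition supports x T : Prop :=
  [/\ (x <= N)%MS, forall i, x 0 i <= 1 & forall i, (x 0 i == 1) = (i \in T)].

Definition config_facet T : Prop := full N T /\ exists x, supports x T.

Definition almost_simplicial_config F : Prop :=
  [/\ forall x, (x <= N)%MS -> \sum_i x 0 i = 0,
      (0 < d)%N, config_facet F &
      forall T, config_facet T -> T = F \/ #|T| = d].

Definition other_facets F : {set {set 'I_n}} :=
  [set G | `[< config_facet G /\ G <> F >]].

Definition faces_of (K : {set {set 'I_n}}) : {set {set 'I_n}} :=
  [set T : {set 'I_n} | [exists G in K, T \subset G]].

(** The ball relative to its boundary, the boundary of P' being that of [F]. *)
Definition faces_off (F : {set 'I_n}) (K : {set {set 'I_n}}) : {set {set 'I_n}} :=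
  [set T in faces_of K | ~~ (T \subset F)].

Lemma faces_ofP (K : {set {set 'I_n}}) T : reflect (exists2 G, G \in K & T \subset G) (T \in faces_of K).
Proof.
by rewrite inE; apply: (iffP existsP) => [[G /andP[]]|[G h1 h2]]; exists G => //; apply/andP.
Qed.

Lemma other_facetsP F G : reflect (config_facet G /\ G <> F) (G \in other_facets F).
Proof. by rewrite inE; apply: asboolP. Qed.

Section Fixed.
Variable F : {set 'I_n}.
Hypothesis confF : almost_simplicial_config F.
Let sumN : forall x, (x <= N)%MS -> \sum_i x 0 i = 0.
Proof. by case: confF. Qed.
Let fullF : full N F. Proof. by case: confF => _ _ []. Qed.

Lemma other_facet_basis G : G \in other_facets F -> basis N G.
Proof. by case: confF => _ _ _ h /other_facetsP[fG GF]; case: (h G fG) => //; split; case: fG. Qed.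

Lemma config_dim_lt : (0 < n)%N /\ (#|F| < n)%N.
Proof.
case: confF => _ d0 [_ [x [xN x1 xF]]] _.
have n0 : (0 < n)%N by rewrite (leq_trans d0) // rank_leq_col.
split=> //; rewrite ltn_neqAle -[X in (_ <= X)%N]card_ord max_card andbT.
apply/negP => /eqP cF.
have FT : F = [set: 'I_n] by apply/eqP; rewrite eqEcard subsetT cardsT card_ord cF leqnn.
have := sumN xN; rewrite (eq_bigr (fun=> 1)) => [|i _]; last first.
  by apply/eqP; rewrite xF FT inE.
by rewrite sumr_const card_ord => /eqP; rewrite pnatr_eq0 eqn0Ngt n0.
Qed.

(** Two supporting functionals equal to 1 on the spanning set [G] coincide, so [G] inside [F] would
    force [G = F]. *)
Lemma other_facet_nsub G : G \in other_facets F -> ~~ (G \subset F).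
Proof.
move=> GK; apply/negP => GF; have bG := other_facet_basis GK.
case/other_facetsP: GK => -[fG [x [xN x1 xG]]] neGF; apply: neGF.
case: confF => _ _ [_ [y [yN y1 yF]]] _.
have xy : x = y.
  apply: (full_eq fG) => // i iG; transitivity (1 : R).
    by apply/eqP; rewrite xG.
  by apply/esym/eqP; rewrite yF (subsetP GF).
by apply/setP => i; rewrite -xG -yF xy.
Qed.

Lemma other_facet_supports G : G \in other_facets F -> supports (ext N G (const_mx 1)) G.
Proof.
move=> GK; have bG := other_facet_basis GK.
case/other_facetsP: GK => -[fG [x [xN x1 xG]]] _.
suff <- : x = ext N G (const_mx 1) by [].
by apply: ext_eq => // i iG; rewrite mxE; apply/eqP; rewrite xG.
Qed.

(* Raising the height of point [i] by [e ^ i.+1] with [e] small refines the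
   face fan of the polytope to a simplicial fan without new rays. *)
Lemma perturbed_height : exists2 c, generic_height N c &
  forall G, basis N G ->
    ((forall i, i \notin G -> ext N G (const_mx 1) 0 i < 1) -> G \in fan N c) /\
    (G \in fan N c -> forall i, ext N G (const_mx 1) 0 i <= 1).
Proof.
pose h (e : R) : 'rV[R]_n := \row_i (1 + e ^+ i.+1).
(* The excess of the interpolation over the height at [i], as a polynomial in [e]. The exponents
   being distinct, its coefficient at ['X^(i.+1)] is -1 for [i] outside [G]; its constant term
   belongs to the unperturbed heights 1. *)
pose p G (i : 'I_n) : {poly R} :=
  \sum_(j in G) (1 + 'X^(j.+1)) * (dual N G j 0 i)%:P - (1 + 'X^(i.+1)).
have pE G i e : basis N G -> (p G i).[e] = ext N G (h e) 0 i - h e 0 i.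
  move=> bG; rewrite [ext _ _ _](dual_expand bG (ext_sub _ bG)) summxE.
  rewrite /p hornerD horner_sum hornerN !hornerE /= mxE; congr (_ - _).
  by apply: eq_bigr => j jG; rewrite !hornerE /= mxE extE // mxE.
have h0 : h 0 = const_mx 1.
  by apply/matrixP => i j; rewrite !mxE expr0n addr0.
have p0 G i : i \notin G -> p G i != 0.
  move=> iG; apply/negP => /eqP/(congr1 (fun q : {poly R} => q`_i.+1)).
  rewrite coef0 coefB coef_sum coefD coef1 coefXn eqxx add0r big1 ?sub0r => [|j jG].
    by move/eqP; rewrite oppr_eq0 oner_eq0.
  rewrite coefMC coefD coef1 coefXn add0r eqSS val_eqE.
  by rewrite (negPf (_ : i != j)) ?mul0r //; apply: contraNneq iG => ->.
have [e e0 he] := small_parameter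
  [seq p Gi.1 Gi.2 | Gi <- enum [set: {set 'I_n} * 'I_n]].
have {}he G i : (p G i != 0 -> (p G i).[e] != 0) /\
    ((p G i).[0] != 0 -> Num.sg (p G i).[e] = Num.sg (p G i).[0]).
  by apply: he; apply/mapP; exists (G, i); rewrite ?mem_enum ?finset.in_setT.
exists (h e) => [G i bG iG|G bG].
  by rewrite -subr_eq0 -pE //; apply: (proj1 (he G i)); exact: p0.
have sgE i : ext N G (const_mx 1) 0 i != 1 ->
    Num.sg (ext N G (h e) 0 i - h e 0 i) = Num.sg (ext N G (const_mx 1) 0 i - 1).
  move=> ne; rewrite -pE //; case: (he G i) => _ ->; rewrite pE // h0 [const_mx 1 _ _]mxE //.
  by rewrite subr_eq0.
split=> [lt1|/fanP[_ hG] i].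
  apply/fanP; split=> // i iG; rewrite -subr_lt0 -sgr_lt0 sgE ?lt_eqF ?lt1 //.
  by rewrite sgr_lt0 subr_lt0 lt1.
case: (boolP (i \in G)) => iG; first by rewrite extE // mxE.
rewrite leNgt; apply/negP => gt1.
have ne1 : ext N G (const_mx 1) 0 i != 1 by rewrite (gt_eqF gt1).
have := sgE i ne1.
have hl : ext N G (h e) 0 i - h e 0 i < 0 by rewrite subr_lt0 hG.
have hr : 0 < ext N G (const_mx 1) 0 i - 1 by rewrite subr_gt0.
by rewrite (ltr0_sg hl) (gtr0_sg hr); lra.
Qed.

(** Before perturbation, a cone not inside [F] is tight on a facet [Z] containing it. As [Z] differs
    from [F], it is a simplex and cannot be subdivided. *)
Lemma refining_fan : exists2 c, generic_height N c &
  forall G, (G \in other_facets F) = (G \in fan N c) && ~~ (G \subset F).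
Proof.
have [c gc hc] := perturbed_height; exists c => // G; apply/idP/andP.
  move=> GK; have bG := other_facet_basis GK; have [_ x1 xG] := other_facet_supports GK.
  split; last exact: other_facet_nsub.
  apply: (proj1 (hc G bG)) => i iG; rewrite lt_neqAle xG (negPf iG) /=; exact: x1.
move=> [Gc GF]; have bG := fan_basis Gc; have {}hc := proj2 (hc G bG) Gc.
pose Z := [set i | ext N G (const_mx 1) 0 i == 1].
have GZ : G \subset Z by apply/subsetP => i iG; rewrite inE extE // mxE.
have fZ : config_facet Z.
  split; first by apply: full_sub GZ _; case: bG.
  by exists (ext N G (const_mx 1)); split=> // [|i]; [exact: ext_sub|rewrite inE].
have ZF : Z <> F by move=> E; rewrite -E GZ in GF.
case: confF => _ _ _ /(_ Z fZ) [//|cZ].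
have -> : G = Z by apply/eqP; rewrite eqEcard GZ cZ (proj2 bG) leqnn.
by apply/other_facetsP.
Qed.

(** The vector w is generic and in the relative interior of the cone over [T]. *)
Definition weight_on T nu : Prop :=
  [/\ generic_weight N nu, forall i, i \in T -> 0 < nu 0 i &
      forall i, i \notin T -> nu 0 i = 0].

Lemma weight_near T v : full N T -> v \in T -> exists2 nu, weight_on T nu &
  forall G, basis N G -> v \in G -> 0 < coef N nu G v.
Proof.
move=> fT vT.
(* Exponent 0 at [v] and distinct positive ones elsewhere: w is [v] plus infinitesimal multiples of
   the other points of [T], so its coordinate at [v] tends to 1. The coordinates are nonzero
   polynomials in [e] because a dual functional cannot vanish on all of the spanning set [T]. *)
pose expo (i : 'I_n) := if i == v then 0%N else i.+1.
have expo_inj : injective expo.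
  move=> i j; rewrite /expo; case: eqVneq => [->|iv]; case: eqVneq => [->|jv] //.
  by case=> /val_inj.
pose w (e : R) : 'rV[R]_n := \row_i (if i \in T then e ^+ expo i else 0).
pose p G j : {poly R} := \sum_(i in T) (dual N G j 0 i) *: 'X^(expo i).
have pE G j e : (p G j).[e] = coef N (w e) G j.
  rewrite /coef /pair horner_sum big_mkcond; apply: eq_bigr => i _.
  by rewrite mxE; case: ifP => _; rewrite ?mul0r // !hornerE mulrC.
have pX G j i : i \in T -> (p G j)`_(expo i) = dual N G j 0 i.
  move=> iT; rewrite coef_sum (bigD1 i) //= coefZ coefXn eqxx mulr1 big1 ?addr0 //.
  move=> k /andP[_ ki]; rewrite coefZ coefXn (inj_eq expo_inj) eq_sym (negPf ki).
  by rewrite mulr0.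
have p0 G j : basis N G -> j \in G -> p G j != 0.
  move=> bG jG; apply/negP => /eqP p0.
  have : dual N G j = 0.
    apply: fT; first exact: dual_sub.
    by move=> i iT; rewrite -(pX G j i iT) p0 coef0.
  move/rowP/(_ j); rewrite dualE // eqxx mxE => /eqP; by rewrite oner_eq0.
have pv G : basis N G -> v \in G -> (p G v).[0] = 1.
  move=> bG vG; have := pX G v v vT.
  by rewrite {1}/expo eqxx horner_coef0 dualE // eqxx.
have [e e0 he] := small_parameter
  [seq p Gi.1 Gi.2 | Gi <- enum [set: {set 'I_n} * 'I_n]].
have {}he G i : (p G i != 0 -> (p G i).[e] != 0) /\
    ((p G i).[0] != 0 -> Num.sg (p G i).[e] = Num.sg (p G i).[0]).
  by apply: he; apply/mapP; exists (G, i); rewrite ?mem_enum ?finset.in_setT.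
exists (w e) => [|G bG vG].
  split=> [G j bG jG|i iT|i iT]; last by rewrite mxE (negPf iT).
    by rewrite -pE; apply: (proj1 (he G j)); exact: p0.
  by rewrite mxE iT exprn_gt0.
by rewrite -pE -sgr_gt0 (proj2 (he G v)) pv ?oner_eq0 // sgr1 ltr01.
Qed.

(** The supporting hyperplane turns about the points of [T] until it meets another point. *)
Lemma supports_rotate x T (e : 'rV[R]_n) : supports x T -> (e <= N)%MS -> e != 0 ->
  (forall i, i \in T -> e 0 i = 0) ->
  exists t T', [/\ 0 < t, supports (x + t *: e) T' & T \proper T'].
Proof.
move=> [xN x1 xT] eN e0 eT.
have [|i ei|t [i0 [t0 ei0 y0 y1]]] := ratio_test sumN (c := const_mx 1) (x := x) eN e0.
- by move=> i; rewrite mxE.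
- rewrite mxE lt_neqAle x1 andbT xT; apply/negP => /eT ei0.
  by rewrite ei0 ltxx in ei.
exists t, [set i | (x + t *: e) 0 i == 1]; split=> //.
  split=> [|i|i]; last by rewrite inE.
  - by rewrite addmx_sub // scalemx_sub.
  - by have := y1 i; rewrite [const_mx 1 _ _]mxE.
rewrite properE; apply/andP; split.
  apply/subsetP => i iT; rewrite inE !mxE eT // mulr0 addr0; by rewrite xT.
apply/subsetPn; exists i0; first by rewrite inE y0 mxE.
by apply/negP => /eT ez; rewrite ez ltxx in ei0.
Qed.

(* If rotating about [T] in one direction reaches [F], the opposite rotation
   does not. *)
Lemma other_facet_above x T : supports x T -> T != F ->
  exists2 G, G \in other_facets F & T \subset G.
Proof.
move=> sT TF.
(* This is the condition carried through the rotations. It holds here since a facet with d elements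
   that contains the spanning set [F] equals [F]. *)
have {TF}: ~~ (F \subset T).
  apply: contra TF => FT; case: confF => _ _ _ h.
  have fT : config_facet T by split; [exact: full_sub FT fullF|exists x].
  case: (h T fT) => [->//|cT]; rewrite eq_sym eqEcard FT cT.
  exact: full_card.
have [k] := ubnP (n - #|T|); elim: k => // k IH in x T sT *; rewrite ltnS => nk FT.
have [fT|nfT] := pselect (full N T).
  exists T => //; apply/other_facetsP; split; first by split=> //; exists x.
  by move=> TF; rewrite TF subxx in FT.
have [e [eN e0 eT]] : exists e : 'rV[R]_n, [/\ (e <= N)%MS, e != 0 & forall i, i \in T -> e 0 i = 0].
  apply: contrapT => h; apply: nfT => e eN eT; apply/eqP; apply: contraT => e0.
  by case: h; exists e.
have step y T' : supports y T' -> T \proper T' -> ~~ (F \subset T') ->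
    exists2 G, G \in other_facets F & T \subset G.
  move=> sT' TT' FT'; have := proper_card TT'.
  have : (#|T'| <= n)%N by rewrite -[X in (_ <= X)%N]card_ord max_card.
  move=> cT' lt; have [|G GF TG] := IH y T' sT' _ FT'; first by lia.
  by exists G => //; apply: subset_trans TG; exact: proper_sub.
have [t [T1 [t0 s1 p1]]] := supports_rotate sT eN e0 eT.
have [F1|] := boolP (F \subset T1); last exact: step s1 p1.
have [||i iT|t' [T2 [t'0 s2 p2]]] := @supports_rotate x T (- e) sT.
- by rewrite eqmx_opp.
- by rewrite oppr_eq0.
- by rewrite mxE eT ?oppr0.
have [F2|] := boolP (F \subset T2); last exact: step s2 p2.
case/subsetPn: FT => i iF /negP[]; case: sT => _ _ <-.
have /eqP h1 : (x + t *: e) 0 i == 1 by case: s1 => _ _ ->; exact: (subsetP F1).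
have /eqP h2 : (x + t' *: - e) 0 i == 1 by case: s2 => _ _ ->; exact: (subsetP F2).
move: h1 h2; rewrite !mxE => h1 h2.
have : (t + t') * e 0 i = 0 by lra.
move/eqP; rewrite mulf_eq0 gt_eqF ?addr_gt0 //= => /eqP ei.
by rewrite -h1 ei mulr0 addr0.
Qed.

(** The supporting functional of the simplex [G] is tilted by a small multiple of a functional that
    is 0 on [T] and -1 on the rest of [G]; points outside [G] keep positive slack. *)
Lemma sub_facet_supports G T : G \in other_facets F -> T \subset G ->
  exists x, supports x T.
Proof.
move=> GK TG; have bG := other_facet_basis GK; have [xN x1 xG] := other_facet_supports GK.
set x := ext _ _ _ in xN x1 xG.
pose e := ext N G (\row_i (if i \in T then 0 else -1)).
pose p i : {poly R} := (x 0 i - 1)%:P + (e 0 i)%:P * 'X.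
have [t t0 ht] := small_parameter [seq p i | i <- enum 'I_n].
have ylt i : i \notin T -> (x + t *: e) 0 i < 1.
  move=> iT; rewrite !mxE; case: (boolP (i \in G)) => iG.
    have -> : e 0 i = -1 by rewrite /e extE // mxE (negPf iT).
    by rewrite (eqP (_ : x 0 i == 1)) ?xG //; lra.
  have xi : x 0 i - 1 < 0 by rewrite subr_lt0 lt_neqAle xG iG x1.
  have /ht[_] : p i \in [seq p i | i <- enum 'I_n] by rewrite map_f // mem_enum.
  rewrite !hornerE (lt_eqF xi) => /(_ isT); rewrite (ltr0_sg xi) => /eqP.
  by rewrite sgr_cp0; lra.
have yT i : i \in T -> (x + t *: e) 0 i = 1.
  move=> iT; have ei : e 0 i = 0 by rewrite /e extE ?(subsetP TG) // mxE iT.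
  by rewrite !mxE ei mulr0 addr0; apply/eqP; rewrite xG (subsetP TG).
exists (x + t *: e); split=> [|i|i].
- by rewrite addmx_sub // scalemx_sub // ext_sub.
- by case: (boolP (i \in T)) => [/yT ->//|/ylt/ltW].
by apply/eqP/idP => [E|/yT //]; apply: contraT => /ylt; rewrite E ltxx.
Qed.

Lemma pair_support nu : weight_on F nu -> forall x, (forall i, x 0 i <= 1) ->
  pair nu x <= \sum_(i in F) nu 0 i ?= iff [forall i in F, x 0 i == 1].
Proof.
move=> [_ nuF nu0] x x1.
have -> : pair nu x = \sum_(i in F) nu 0 i * x 0 i.
  rewrite /pair [in RHS]big_mkcond; apply: eq_bigr => i _.
  by case: ifPn => // iF; rewrite nu0 // mul0r.
apply: leif_sum => i iF; split; first by rewrite ler_piMr // ltW // nuF.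
by rewrite -subr_eq0 -{2}[nu 0 i]mulr1 -mulrBr mulf_eq0 gt_eqF ?nuF //= subr_eq0.
Qed.

Let supportF : exists x, supports x F. Proof. by case: confF => _ _ []. Qed.

(** Let x and y support [G] and [F]. If [T] were inside [F], then x - y would vanish on [T] and be
    nonnegative on [G], so x(w) >= y(w). As y(w) is maximal, equality holds and complementary
    slackness puts [G] inside [F]. *)
Lemma weight_cone_off nu G T : weight_on F nu -> G \in other_facets F ->
  neg N nu G \subset T -> T \subset G -> ~~ (T \subset F).
Proof.
move=> wnu GK nT TG; apply/negP => TF.
have bG := other_facet_basis GK; have [xN x1 xG] := other_facet_supports GK.
set x := ext _ _ _ in xN x1 xG; have [y [yN y1 yF]] := supportF.
have gnu : generic_weight N nu by case: wnu.
have xE i : i \in G -> x 0 i = 1 by move=> iG; apply/eqP; rewrite xG.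
have h1 : pair nu x <= pair nu y.
  have [_ e] := pair_support wnu y1; have [le _] := pair_support wnu x1.
  apply: le_trans le _; rewrite le_eqVlt eq_sym e; apply/orP; left.
  by apply/forallP => i; apply/implyP; rewrite yF.
have := @sum_coef_ge0 _ _ _ N nu G T (fun j => (x - y) 0 j) gnu bG nT.
case=> [j jG jT|j jG|ge0 eq0].
- by rewrite !mxE xE // (eqP (_ : y 0 j == 1)) ?subrr // yF (subsetP TF).
- by rewrite !mxE xE // subr_ge0.
rewrite -pair_coef // in ge0 eq0; last by rewrite addmx_sub // eqmx_opp.
have /eqP E : 0 == pair nu (x - y) by rewrite eq_le ge0 pairD pairN subr_le0.
move: eq0; rewrite -E eqxx => /esym/forallP h.
have /subsetPn[j jG jF] := other_facet_nsub GK.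
move: (h j); rewrite jG /= !mxE xE // subr_eq0 eq_sym yF.
by rewrite (negPf jF).
Qed.

(** Let x and y support [G0] and [F]. If [G] were inside [F], then y - x would vanish on [T] and be
    nonnegative on [G]; pairing with -w gives y(w) <= x(w). Maximality of y(w) makes x equal to 1 on
    [F], so [F] lies in [G0] and equals it by cardinality. *)
Lemma weight_cone_on nu c G0 G T : weight_on F nu -> G0 \in other_facets F ->
  T \subset G0 -> G \in fan N c -> neg N (- nu) G \subset T -> T \subset G ->
  ~~ (G \subset F).
Proof.
move=> wnu G0K TG0 Gc nT TG; apply/negP => GF; have bG := fan_basis Gc.
have b0 := other_facet_basis G0K; have [xN x1 xG] := other_facet_supports G0K.
set x := ext _ _ _ in xN x1 xG; have [y [yN y1 yF]] := supportF.
have gnu : generic_weight N (- nu) by apply: generic_weight_opp; case: wnu.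
have yE i : i \in F -> y 0 i = 1 by move=> iF; apply/eqP; rewrite yF.
have := @sum_coef_ge0 _ _ _ N (- nu) G T (fun j => (y - x) 0 j) gnu bG nT.
case=> [j jG jT|j jG|ge0 _].
- rewrite !mxE yE ?(subsetP GF) // (eqP (_ : x 0 j == 1)) ?subrr //.
  by rewrite xG (subsetP TG0).
- by rewrite !mxE yE ?(subsetP GF) // subr_ge0.
rewrite -pair_coef // in ge0; last by rewrite addmx_sub // eqmx_opp.
rewrite pairNl oppr_ge0 pairD pairN subr_le0 in ge0.
have [le e] := pair_support wnu x1; have [_ ey] := pair_support wnu y1.
have {}ey : pair nu y = \sum_(i in F) nu 0 i.
  by apply/eqP; rewrite ey; apply/forallP => i; apply/implyP; rewrite yF.
rewrite ey in ge0; move: e; rewrite eq_le le ge0 => /esym/forallP h.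
have FG0 : F \subset G0.
  by apply/subsetP => i iF; rewrite -xG; have := h i; rewrite iF.
have /negP := other_facet_nsub G0K; apply.
suff -> : G0 = F by [].
by apply/eqP; rewrite eq_sym eqEcard FG0 (proj2 b0) (full_card fullF).
Qed.

Lemma fan_partition c nu : generic_height N c -> generic_weight N nu ->
  interval_partition d (fan N c) (neg N nu) (faces_of (fan N c)).
Proof.
move=> gc gnu; split.
- move=> G /fan_basis[_ cG]; split=> //.
  by apply/subsetP => i; rewrite inE => /andP[].
- by move=> T /faces_ofP[G0 G0F TG0]; apply: (fan_cover sumN gc gnu G0F TG0).
- by move=> G G' T GF G'F nG TG nG' TG'; apply: (fan_unique gnu GF G'F nG TG nG' TG').
by move=> G T GF _ TG; apply/faces_ofP; exists G.
Qed.

(** A set not contained in [F] lies only in cones not inside [F]; conversely the intervals of these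
    cones avoid the subsets of [F]. *)
Lemma off_partition nu : weight_on F nu ->
  interval_partition d (other_facets F) (neg N nu) (faces_off F (other_facets F)).
Proof.
move=> wnu; have [c gc cF] := refining_fan; have gnu : generic_weight N nu by case: wnu.
have [P1 P2 P3 P4] := fan_partition gc gnu; split.
- by move=> G; rewrite cF => /andP[/P1].
- move=> T; rewrite inE => /andP[/faces_ofP[G0 G0F TG0] TF].
  have : T \in faces_of (fan N c).
    by apply/faces_ofP; exists G0 => //; move: G0F; rewrite cF => /andP[].
  case/P2=> G [GF nT TG]; exists G; split=> //; rewrite cF GF /=.
  by apply: contra TF; apply: subset_trans.
- by move=> G G' T; rewrite !cF => /andP[GF _] /andP[G'F _]; apply: P3.
move=> G T GF nT TG; rewrite inE (weight_cone_off wnu GF nT TG) andbT.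
by apply/faces_ofP; exists G.
Qed.

(** For -w, the cone whose interval contains a given face of P' is never inside [F], so discarding
    the pieces of [F] loses no face. *)
Lemma on_partition nu : weight_on F nu ->
  interval_partition d (other_facets F) (neg N (- nu)) (faces_of (other_facets F)).
Proof.
move=> wnu; have [c gc cF] := refining_fan.
have gnu : generic_weight N (- nu) by apply: generic_weight_opp; case: wnu.
have [P1 P2 P3 P4] := fan_partition gc gnu; split.
- by move=> G; rewrite cF => /andP[/P1].
- move=> T /faces_ofP[G0 G0F TG0].
  have : T \in faces_of (fan N c).
    by apply/faces_ofP; exists G0 => //; move: G0F; rewrite cF => /andP[].
  case/P2=> G [GF nT TG]; exists G; split=> //; rewrite cF GF /=.
  exact: (weight_cone_on wnu G0F TG0 GF nT TG).
- by move=> G G' T; rewrite !cF => /andP[GF _] /andP[G'F _]; apply: P3.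
by move=> G T GF _ TG; apply/faces_ofP; exists G.
Qed.

(** For a weight close to [v], the coordinate at [v] is positive in every cone containing [v], so
    adding [v] enlarges each restriction set by one. Both counts are independent of the weight. *)
Lemma fan_link_le c nu v k : generic_height N c -> generic_weight N nu ->
  (hcount (link_facets (fan N c) v) (link_restr (neg N nu) v) k.+1 <=
   hcount (fan N c) (neg N nu) k)%N.
Proof.
move=> gc gnu.
have fullT : full N [set: 'I_n] by apply: full_sub (finset.subsetT F) fullF.
have [nu' [gnu' _ _] nu'v] := weight_near fullT (finset.in_setT v).
have P := fan_partition gc gnu; have P' := fan_partition gc gnu'.
rewrite (hcount_unique k P P').
rewrite (hcount_unique _ (interval_partition_link P v) (interval_partition_link P' v)).
apply: hcount_link_le => G GF vG; rewrite inE vG /= -leNgt.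
by apply/ltW/nu'v => //; exact: fan_basis GF.
Qed.

Lemma fan_upper_bound c nu k : generic_height N c -> generic_weight N nu ->
  (k <= d)%N -> (hcount (fan N c) (neg N nu) k <= 'C(n - d - 1 + k, k))%N.
Proof.
move=> gc gnu; have P := fan_partition gc gnu.
apply: (@h_bound _ _ _ (hcount (fan N c) (neg N nu))) => [||{}k kd].
- by case: config_dim_lt => _; apply: leq_ltn_trans (full_card fullF).
- rewrite /hcount; apply/card_le1_eqP => G G' /setIdP[GF n0] /setIdP[G'F n0'].
  by apply/esym; apply: (fan_unique (T := finset.set0) gnu GF G'F); rewrite ?sub0set ?finset.subset0 -?cards_eq0.
rewrite -(sum_hcount_link P) -[X in (_ <= X * _)%N]card_ord -sum_nat_const.
by apply: leq_sum => v _; apply: fan_link_le.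
Qed.

Lemma hcount_sub (K K' : {set {set 'I_n}}) r k : K \subset K' ->
  (hcount K r k <= hcount K' r k)%N.
Proof.
move=> /subsetP KK'; apply: subset_leq_card; apply/subsetP => G.
by rewrite !inE => /andP[/KK' -> ->].
Qed.

Lemma off_upper_bound nu k : weight_on F nu -> (k <= d)%N ->
  (hcount (other_facets F) (neg N nu) k + 'C(#|F| - d + k - 1, k) <=
     'C(n - d - 1 + k, k))%N.
Proof.
move=> wnu; have gnu : generic_weight N nu by case: wnu.
have [c gc cF] := refining_fan; have P := off_partition wnu.
have dF := full_card fullF.
have [n0 Fn] := config_dim_lt.
apply: (@h_bound_relative _ _ _ _ (hcount (other_facets F) (neg N nu))); rewrite ?subnKC //; first by apply: leq_ltn_trans Fn.
  (* A cone with empty restriction set would have the empty set, a subset of [F], in its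
     interval. *)
  apply/eqP; rewrite cards_eq0; apply/eqP/setP => G; rewrite finset.in_set0.
  apply/negP => /setIdP[GK]; rewrite cards_eq0 => /eqP n0'.
  by have := weight_cone_off (T := finset.set0) wnu GK; rewrite n0' !sub0set => /(_ isT isT).
move=> {}k kd; rewrite -(sum_hcount_link P) (bigID (mem F)) /= leq_add //.
  rewrite -sum_nat_const; apply: leq_sum => v vF.
  (* For [v] in [F], a weight close to [v] can be taken inside the cone over [F], so the relative
     partition stays available. *)
  have [nu' wnu' nu'v] := weight_near fullF vF; have P' := off_partition wnu'.
  rewrite (hcount_unique k P P').
  rewrite (hcount_unique _ (interval_partition_link P v) (interval_partition_link P' v)).
  apply: hcount_link_le => G GF vG; rewrite inE vG /= -leNgt.
  by apply/ltW/nu'v => //; exact: other_facet_basis GF.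
have -> : (n - d - (#|F| - d) = #|~: F|)%N by rewrite [#|~: F|]cardsCs setCK card_ord; lia.
rewrite (eq_bigl (mem (~: F))) => [|v]; last by rewrite !inE.
rewrite -sum_nat_const; apply: leq_sum => v _.
(* For [v] outside [F], the link is compared with the whole fan, whose h-numbers are already
   bounded. *)
apply: leq_trans (fan_upper_bound gc gnu (ltnW kd)).
apply: leq_trans (fan_link_le v k gc gnu); apply: hcount_sub.
by apply/subsetP => G /setIdP[]; rewrite cF => /andP[GF _] vG; apply/setIdP.
Qed.

(** Changing the sign of w exchanges its positive and negative coordinates. This duality between the
    ball and its interior is the source of the index d-k. *)
Lemma neg_opp nu G : weight_on F nu -> G \in other_facets F ->
  (#|neg N nu G| + #|neg N (- nu) G| = d)%N.
Proof.
move=> [gnu _ _] GK; have bG := other_facet_basis GK.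
have -> : neg N (- nu) G = G :\: neg N nu G.
  apply/setP => j; rewrite !inE; case jG : (j \in G) => //=.
  by rewrite andbT /coef pairNl oppr_lt0 -leNgt le_eqVlt eq_sym (negPf (gnu _ _ bG jG)).
have sub : neg N nu G \subset G by apply/subsetP => j; rewrite inE => /andP[].
by rewrite cardsD (setIidPr sub) subnKC ?(proj2 bG) // -(proj2 bG) subset_leq_card.
Qed.

(* [h k] is h_k of the ball formed by the facets other than [F]; [h (d - k)]
   counts the same facets when the shelling is reversed to start from [F]. *)
Theorem config_h_vector : exists h : nat -> nat,
  [/\ forall i, (i <= d)%N -> fcount (faces_of (other_facets F)) i =
        (\sum_(k < d.+1) h k * 'C(d - k, d - i))%N,
      forall i, (i <= d)%N -> fcount (faces_off F (other_facets F)) i =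
        (\sum_(k < d.+1) h (d - k) * 'C(d - k, d - i))%N,
      forall k, (k <= d)%N -> (h k <= 'C(n - d - 1 + k, k))%N &
      forall k, (k <= d)%N ->
        (h (d - k) + 'C(#|F| - d + k - 1, k) <= 'C(n - d - 1 + k, k))%N].
Proof.
have d0 : (0 < d)%N by case: confF.
have [v vF] : exists v, v \in F.
  by apply/set0Pn; rewrite -card_gt0 (leq_trans d0) // (full_card fullF).
have [nu wnu _] := weight_near fullF vF; have [c gc cF] := refining_fan.
have gnu : generic_weight N (- nu) by apply: generic_weight_opp; case: wnu.
have rev k : (k <= d)%N ->
    hcount (other_facets F) (neg N (- nu)) (d - k)%N = hcount (other_facets F) (neg N nu) k.
  move=> kd; apply: eq_card => G; rewrite [LHS]inE [RHS]inE.
  case GK : (G \in other_facets F) => //=; move: (neg_opp wnu GK).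
  pose a := #|neg N nu G|; pose b := #|neg N (- nu) G|; rewrite -/a -/b => ab.
  rewrite -[LHS]/(b == (d - k)%N) -[RHS]/(a == k).
  by apply/eqP/eqP; lia.
exists (hcount (other_facets F) (neg N (- nu))); split.
- exact: fcount_hcount (on_partition wnu).
- move=> i id; rewrite (fcount_hcount (off_partition wnu)) //.
  by apply: eq_bigr => k _; rewrite rev // -ltnS.
- move=> k kd; apply: leq_trans (fan_upper_bound gc gnu kd); apply: hcount_sub.
  by apply/subsetP => G; rewrite cF => /andP[].
by move=> k kd; rewrite rev //; apply: off_upper_bound.
Qed.

End Fixed.
End Configuration.

(** * Convex hulls and their faces *)

Section Hulls.
Local Open Scope classical_set_scope.
Local Open Scope ring_scope.
Variables (R : realType) (m : nat).
Local Notation V := 'rV[R]_m.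
Implicit Types (c x : V) (b : R).

Definition dot c x : R := \sum_j c 0 j * x 0 j.

Lemma dotDr c x y : dot c (x + y) = dot c x + dot c y.
Proof. by rewrite -big_split; apply: eq_bigr => j _; rewrite mxE mulrDr. Qed.
Lemma dotZr c a x : dot c (a *: x) = a * dot c x.
Proof. by rewrite mulr_sumr; apply: eq_bigr => j _; rewrite mxE; ring. Qed.
Lemma dotNr c x : dot c (- x) = - dot c x.
Proof. by rewrite -scaleN1r dotZr mulN1r. Qed.
Lemma dot0r c : dot c 0 = 0.
Proof. by rewrite -(scale0r 0) dotZr mul0r. Qed.
Lemma dot_sumr c (I : finType) (w : I -> R) (p : I -> V) :
  dot c (\sum_i w i *: p i) = \sum_i w i * dot c (p i).
Proof.
rewrite (big_morph (dot c) (dotDr c) (dot0r c)).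
by apply: eq_bigr => i _; rewrite dotZr.
Qed.
Lemma dotC c x : dot c x = dot x c.
Proof. by apply: eq_bigr => j _; rewrite mulrC. Qed.
Lemma dot_delta j x : dot (delta_mx 0 j) x = x 0 j.
Proof.
rewrite /dot (bigD1 j) //= mxE !eqxx mul1r big1 ?addr0 // => k kj.
by rewrite mxE (negPf kj) andbF mul0r.
Qed.

Lemma dot_ext x y : (forall c, dot c x = dot c y) -> x = y.
Proof. by move=> h; apply/rowP => j; rewrite -!dot_delta h. Qed.

Lemma aff_card_le k l (q : 'I_k -> V) (q' : 'I_l -> V) :
  affinely_independent q -> (forall j, aff q' (q j)) -> (k <= l)%N.
Proof.
move=> iq /(_ _)/cid h; pose W : 'M[R]_(k, l) := \matrix_(j, i) projT1 (h j) i.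
suff /eqP <- : row_free W by exact: rank_leq_col.
apply: inj_row_free => a aW; apply/rowP => j; rewrite mxE; apply: (iq (a 0)).
  transitivity (\sum_i (a *m W) 0 i); last by rewrite aW big1 // => i _; rewrite mxE.
  transitivity (\sum_i \sum_j a 0 j * W j i); last by apply: eq_bigr => i _; rewrite mxE.
  rewrite exchange_big; apply: eq_bigr => i _; rewrite -mulr_sumr.
  case: (projT2 (h i)) => s _; rewrite -[LHS]mulr1 -s; congr (_ * _).
  by apply: eq_bigr => l' _; rewrite mxE.
transitivity (\sum_i (a *m W) 0 i *: q' i); last first.
  by rewrite aW big1 // => i _; rewrite mxE scale0r.
transitivity (\sum_i \sum_j (a 0 j * W j i) *: q' i); last first.
  by apply: eq_bigr => i _; rewrite mxE scaler_suml.
rewrite exchange_big; apply: eq_bigr => i _.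
case: (projT2 (h i)) => _ {1}->; rewrite scaler_sumr.
by apply: eq_bigr => l' _; rewrite mxE scalerA.
Qed.

Lemma has_dim_unique (A : set V) e e' : has_dim A e -> has_dim A e' -> e = e'.
Proof.
move=> [k [q [-> qA iq Aq]]] [l [q' [-> q'A iq' Aq']]].
have h1 : (k <= l)%N by apply: (aff_card_le iq) => j; apply/Aq'/qA.
have h2 : (l <= k)%N by apply: (aff_card_le iq') => j; apply/Aq/q'A.
by rewrite (_ : k = l) //; apply/eqP; rewrite eqn_leq h1.
Qed.

Section Family.
Variables (n : nat) (p : 'I_n -> V).
Implicit Types (S T G : {set 'I_n}).

(** Weights are indexed by all points and vanish off [T], so hulls of different subsets are compared
    without reindexing. *)
Definition hull T : set V :=
  [set x | exists w : 'I_n -> R, [/\ forall i, 0 <= w i, forall i, i \notin T -> w i = 0,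
    \sum_i w i = 1 & x = \sum_i w i *: p i]].

Lemma hull_setT : hull [set: 'I_n]%SET = conv p.
Proof.
apply/seteqP; split=> x [w].
  by case=> w0 _ w1 ->; exists w.
by case=> w0 w1 ->; exists w; split=> // i; rewrite finset.in_setT.
Qed.

Lemma hull_sub S T : S \subset T -> hull S `<=` hull T.
Proof.
move=> /fintype.subsetP ST x [w [w0 wS w1 xE]]; exists w; split=> // i iT.
by apply: wS; apply: contra iT; apply: ST.
Qed.

Lemma hull_point T i : i \in T -> hull T (p i).
Proof.
move=> iT; exists (fun j => (j == i)%:R); split.
- by move=> j; rewrite ler0n.
- by move=> j jT; case: eqP => // ji; rewrite ji iT in jT.
- by rewrite (bigD1 i) //= eqxx big1 ?addr0 // => j /negPf ->.
by rewrite (bigD1 i) //= eqxx scale1r big1 ?addr0 // => j /negPf ->; rewrite scale0r.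
Qed.

Lemma hull_nonempty T x : hull T x -> exists i, i \in T.
Proof.
move=> [w [w0 wT w1 _]]; apply/existsP; apply: contraT; rewrite negb_exists => /forallP h.
by move: w1; rewrite big1 => [/eqP|i _]; [rewrite eq_sym oner_eq0|exact: wT].
Qed.

Definition tight S c b : {set 'I_n} := [set i in S | dot c (p i) == b]%SET.

Lemma hull_le S c b x : (forall i, i \in S -> dot c (p i) <= b) -> hull S x -> dot c x <= b.
Proof.
move=> cb [w [w0 wS w1 ->]]; rewrite dot_sumr -[b]mul1r -w1 mulr_suml.
apply: ler_sum => i _; have [iS|/wS ->] := boolP (i \in S); last by rewrite !mul0r.
by rewrite ler_wpM2l // cb.
Qed.

Lemma hull_tight S c b : (forall i, i \in S -> dot c (p i) <= b) ->
  hull S `&` [set x | dot c x = b] = hull (tight S c b).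
Proof.
move=> cb; apply/seteqP; split=> x.
  case=> -[w [w0 wS w1 xE]] /= cx; exists w; split=> // i; rewrite inE => ni.
  have [iS|/wS //] := boolP (i \in S); rewrite iS /= in ni.
  have t0 k : true -> 0 <= w k * (b - dot c (p k)).
    move=> _; have [kS|/wS ->] := boolP (k \in S); last by rewrite mul0r.
    by rewrite mulr_ge0 // subr_ge0 cb.
  have : \sum_k w k * (b - dot c (p k)) == 0.
    rewrite (eq_bigr (fun k => w k * b - w k * dot c (p k))) => [|k _]; last by rewrite mulrBr.
    by rewrite sumrB -mulr_suml w1 mul1r -dot_sumr -xE cx subrr.
  rewrite psumr_eq0 // => /allP/(_ i (mem_index_enum _)); rewrite mulf_eq0 subr_eq0.
  by rewrite [b == _]eq_sym (negPf ni) orbF => /eqP.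
case=> w [w0 wT w1 xE]; split=> /=.
  by exists w; split=> // i iS; apply: wT; rewrite inE (negPf iS).
rewrite xE dot_sumr -[b]mul1r -w1 mulr_suml; apply: eq_bigr => i _.
have [|/wT ->] := boolP (i \in tight S c b); last by rewrite !mul0r.
by rewrite inE => /andP[_ /eqP ->].
Qed.

Lemma face_hullP S (G : set V) : face (hull S) G <->
  exists c b, (forall i, i \in S -> dot c (p i) <= b) /\ G = hull (tight S c b).
Proof.
split=> [[c [b [cb ->]]]|[c [b [cb ->]]]]; exists c, b.
  have cb' i : i \in S -> dot c (p i) <= b by move=> /hull_point/cb.
  by rewrite -hull_tight.
by rewrite -hull_tight //; split=> // x; apply: hull_le.
Qed.

Lemma vertices_hull_sub S : vertices (hull S) `<=` p @` [set` S].
Proof.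
move=> v /face_hullP[c [b [_ E]]].
have /hull_nonempty [i iT] : hull (tight S c b) v by rewrite -E.
exists i; first by move: iT; rewrite inE => /andP[].
by have := hull_point iT; rewrite -E.
Qed.

Lemma vertices_hull S : (forall i, i \in S -> vertices (conv p) (p i)) ->
  vertices (hull S) = p @` [set` S].
Proof.
move=> hS; apply/seteqP; split=> [|_ [i /= iS <-]]; first exact: vertices_hull_sub.
have := hS i iS; rewrite /vertices /= -hull_setT => /face_hullP[c [b [cb E]]].
have cbS j : j \in S -> dot c (p j) <= b by move=> _; apply: cb; rewrite finset.in_setT.
apply/face_hullP; exists c, b; split=> //.
have ib : dot c (p i) = b.
  have : hull (tight [set: 'I_n]%SET c b) (p i) by rewrite -E.
  by rewrite -hull_tight // => -[].
apply/seteqP; split=> x.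
  by move=> ->; apply: hull_point; rewrite inE iS ib eqxx.
move=> xT; rewrite E; apply: hull_sub xT; apply/fintype.subsetP => j.
by rewrite !inE => /andP[].
Qed.

Definition aindep T : Prop := forall w : 'I_n -> R, (forall i, i \notin T -> w i = 0) ->
  \sum_i w i = 0 -> \sum_i w i *: p i = 0 -> forall i, w i = 0.

Lemma sum_supported T (w : 'I_n -> R) (W : lmodType R) (f : 'I_n -> W) :
  (forall i, i \notin T -> w i = 0) ->
  \sum_i w i *: f i = \sum_(k < #|T|) w (enum_val k) *: f (enum_val k).
Proof.
move=> wT; rewrite -(big_enum_val (fun i => w i *: f i)) [RHS]big_mkcond.
by apply: eq_bigr => i _; case: ifPn => // /wT ->; rewrite scale0r.
Qed.

Lemma sum1_supported T (w : 'I_n -> R) : (forall i, i \notin T -> w i = 0) ->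
  \sum_i w i = \sum_(k < #|T|) w (enum_val k).
Proof.
move=> wT; rewrite -(big_enum_val w) [RHS]big_mkcond.
by apply: eq_bigr => i _; case: ifPn => // /wT ->.
Qed.

Lemma enum_extend T (w : 'I_#|T| -> R) : exists2 w' : 'I_n -> R,
  forall l, w' (enum_val l) = w l & forall i, i \notin T -> w' i = 0.
Proof.
exists (fun i => \sum_(l : 'I_#|T| | enum_val l == i) w l) => [l|i ni].
  rewrite (bigD1 l) //= big1 ?addr0 // => l' /andP[/eqP/enum_val_inj ->].
  by rewrite eqxx.
rewrite big1 // => l /eqP E.
by move: (enum_valP l); rewrite E (negPf ni).
Qed.

Lemma aindep_enum T : aindep T -> affinely_independent (fun k : 'I_#|T| => p (enum_val k)).
Proof.
move=> iT w w0 wp k; have [w' w'E w'T] := enum_extend w.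
rewrite -w'E; apply: iT => //.
  by rewrite (sum1_supported w'T) -[RHS]w0; apply: eq_bigr => l _; rewrite w'E.
by rewrite (sum_supported _ w'T) -[RHS]wp; apply: eq_bigr => l _; rewrite w'E.
Qed.

Lemma has_dim_hull_span T G : G \subset T -> aindep G ->
  (forall i, i \in T -> exists w : 'I_n -> R, [/\ forall j, j \notin G -> w j = 0,
     \sum_j w j = 1 & p i = \sum_j w j *: p j]) ->
  has_dim (hull T) (#|G|%:Z - 1).
Proof.
move=> GT iG span; exists #|G|, (fun k => p (enum_val k)); split=> //.
- move=> k; apply: hull_point; apply: (fintype.subsetP GT); exact: enum_valP.
- exact: aindep_enum.
move=> x [w [w0 wT w1 ->]].
have /choice [u uP] : forall i, exists u : 'I_n -> R, i \in T ->
    [/\ forall j, j \notin G -> u j = 0, \sum_j u j = 1 & p i = \sum_j u j *: p j].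
  move=> i; have [iT|iT] := boolP (i \in T); last by exists (fun=> 0).
  by have [u h] := span i iT; exists u.
pose v j := \sum_i w i * u i j.
have vG j : j \notin G -> v j = 0.
  move=> jG; rewrite /v big1 // => i _; have [/uP[h _ _]|/wT ->] := boolP (i \in T).
    by rewrite h // mulr0.
  by rewrite mul0r.
exists (fun k => v (enum_val k)); split.
  rewrite -sum1_supported // exchange_big -[RHS]w1; apply: eq_bigr => i _.
  rewrite -mulr_sumr; have [/uP[_ -> _]|/wT ->] := boolP (i \in T); rewrite ?mulr1 //.
  by rewrite mul0r.
rewrite -(sum_supported p vG).
transitivity (\sum_j \sum_i (w i * u i j) *: p j); last first.
  by apply: eq_bigr => j _; rewrite scaler_suml.
rewrite exchange_big; apply: eq_bigr => i _.
have [/uP[_ _ {1}->]|/wT ->] := boolP (i \in T).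
  by rewrite scaler_sumr; apply: eq_bigr => j _; rewrite scalerA.
by rewrite scale0r big1 // => j _; rewrite mul0r scale0r.
Qed.

Lemma has_dim_hull T : aindep T -> has_dim (hull T) (#|T|%:Z - 1).
Proof.
move=> iT; apply: has_dim_hull_span => // i iT'.
exists (fun j => (j == i)%:R); split.
- by move=> j jT; case: eqP => // ji; rewrite ji iT' in jT.
- by rewrite (bigD1 i) //= eqxx big1 ?addr0 // => j /negPf ->.
by rewrite (bigD1 i) //= eqxx scale1r big1 ?addr0 // => j /negPf ->; rewrite scale0r.
Qed.

Definition center : V := n%:R^-1 *: \sum_i p i.

(* Columns are the points relative to their barycentre, so that the row
   space consists of the value vectors of the functionals vanishing at it. *)
Definition centered : 'M[R]_(m, n) := \matrix_(j, i) (p i - center) 0 j.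

Lemma mul_centered c i : (c *m centered) 0 i = dot c (p i) - dot c center.
Proof. by rewrite -dotNr -dotDr mxE; apply: eq_bigr => j _; rewrite mxE. Qed.

Lemma centeredP (x : 'rV[R]_n) : (x <= centered)%MS <->
  exists c, forall i, x 0 i = dot c (p i) - dot c center.
Proof.
split=> [/submxP[c ->]|[c xc]]; first by exists c => i; rewrite mul_centered.
by apply/submxP; exists c; apply/rowP => i; rewrite xc mul_centered.
Qed.

Lemma sum_centered (x : 'rV[R]_n) : (x <= centered)%MS -> \sum_i x 0 i = 0.
Proof.
have [n0|n0] := posnP n.
  by move=> _; rewrite big1 // => i; have := ltn_ord i; rewrite [X in (_ < X)%N]n0.
move=> /centeredP[c xc]; rewrite (eq_bigr _ (fun i _ => xc i)) sumrB sumr_const card_ord.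
rewrite -mulr_natl /center dotZr mulrA divff ?pnatr_eq0 ?gtn_eqF // mul1r.
rewrite (eq_bigr (fun i => 1 * dot c (p i))) => [|i _]; last by rewrite mul1r.
rewrite -dot_sumr (eq_bigr p) ?subrr // => i _; by rewrite scale1r.
Qed.

(** Some point lies strictly below the hyperplane, hence so does the barycentre; dividing by its
    slack [b - dot c center] normalises the functional. *)
Lemma supports_affine c b T : (forall i, dot c (p i) <= b) -> T != [set: 'I_n]%SET ->
  (forall i, (dot c (p i) == b) = (i \in T)) -> exists x : 'rV[R]_n, supports centered x T.
Proof.
move=> cb TT cT.
have [i0 i0T] : exists i, i \notin T.
  by move: TT; rewrite -properT => /properP[_ [i _ iT]]; exists i.
have n0 : n%:R != 0 :> R by rewrite pnatr_eq0 -lt0n (leq_trans _ (ltn_ord i0)).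
have npos : 0 < n%:R :> R by rewrite lt0r n0 ler0n.
pose S := \sum_i (b - dot c (p i)).
have S0 : 0 < S.
  rewrite lt_neqAle sumr_ge0 ?andbT => [|i _]; last by rewrite subr_ge0.
  rewrite eq_sym psumr_eq0 => [|i _]; last by rewrite subr_ge0.
  apply/negP => /allP/(_ i0 (mem_index_enum _)); rewrite /= subr_eq0 eq_sym cT.
  by rewrite (negPf i0T).
have SE : S = n%:R * (b - dot c center).
  rewrite /S sumrB sumr_const card_ord -[b *+ n]mulr_natl mulrBr; congr (_ - _).
  rewrite /center dotZr mulrA divff // mul1r.
  rewrite (eq_bigr (fun i => 1 * dot c (p i))) => [|i _]; last by rewrite mul1r.
  by rewrite -dot_sumr; congr dot; apply: eq_bigr => i _; rewrite scale1r.
have b0 : 0 < b - dot c center by move: S0; rewrite SE pmulr_rgt0.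
pose x : 'rV[R]_n := \row_i ((dot c (p i) - dot c center) / (b - dot c center)).
have xE i : 1 - x 0 i = (b - dot c (p i)) / (b - dot c center).
  by rewrite mxE; field; rewrite gt_eqF.
exists x; split=> [|i|i].
- apply/centeredP; exists ((b - dot c center)^-1 *: c) => i.
  have dZ a y : dot (a *: c) y = a * dot c y by rewrite dotC dotZr dotC.
  by rewrite !dZ mxE; field; rewrite gt_eqF.
- by rewrite -subr_ge0 xE divr_ge0 ?subr_ge0 // -subr_ge0 ltW.
rewrite -cT -[RHS]subr_eq0 -[_ - b]opprB oppr_eq0 -[LHS]subr_eq0 -opprB oppr_eq0 xE.
by rewrite mulf_eq0 invr_eq0 [X in _ || X]gt_eqF // orbF.
Qed.

Lemma supports_face (x : 'rV[R]_n) T S : supports centered x T -> T \subset S ->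
  face (hull S) (hull T).
Proof.
move=> [/centeredP[c xc] x1 xT] /fintype.subsetP TS; apply/face_hullP.
exists c, (1 + dot c center); split=> [i _|].
  by have := x1 i; rewrite xc; lra.
congr hull; apply/setP => i; rewrite inE; apply/idP/andP => [iT|[_ /eqP e]].
  by split; [exact: TS|apply/eqP; move: iT; rewrite -xT xc => /eqP; lra].
by rewrite -xT xc e addrK.
Qed.

Lemma face_supports (G : set V) : face (conv p) G ->
  exists T, G = hull T /\ (T = [set: 'I_n]%SET \/ exists x : 'rV[R]_n, supports centered x T).
Proof.
rewrite -hull_setT => /face_hullP[c [b [cb ->]]].
exists (tight [set: 'I_n]%SET c b); split=> //.
have [E|ne] := eqVneq (tight [set: 'I_n]%SET c b) [set: 'I_n]%SET; [by left|right].
apply: (supports_affine (c := c) (b := b)) => // i.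
  by apply: cb; rewrite finset.in_setT.
by rewrite inE finset.in_setT.
Qed.

Lemma hull_support_mem (x : 'rV[R]_n) T i : supports centered x T -> hull T (p i) -> i \in T.
Proof.
move=> [/centeredP[c xc] x1 xT] hi; rewrite -xT.
have cb j : j \in [set: 'I_n]%SET -> dot c (p j) <= 1 + dot c center.
  by move=> _; have := x1 j; rewrite xc; lra.
suff E : dot c (p i) = 1 + dot c center by rewrite xc E addrK.
have : hull (tight [set: 'I_n]%SET c (1 + dot c center)) (p i).
  rewrite (_ : tight _ _ _ = T) //; apply/setP => j; rewrite inE finset.in_setT -xT xc /=.
  by apply/eqP/eqP; lra.
by rewrite -hull_tight // => -[].
Qed.

(** The dual functional of [i] takes an affine dependence to 0 and sees only the point [i] of [G],
    which isolates [w i]. *)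
Lemma basis_aindep G T : basis centered G -> T \subset G -> aindep T.
Proof.
move=> bG /fintype.subsetP TG w wT w0 wp i.
have [iT|/wT//] := boolP (i \in T).
have /centeredP[c cE] := dual_sub i bG.
have : \sum_j w j * dual centered G i 0 j = 0.
  rewrite (eq_bigr (fun j => w j * dot c (p j) - w j * dot c center)) => [|j _].
    by rewrite sumrB -dot_sumr wp dot0r -mulr_suml w0 mul0r subrr.
  by rewrite cE mulrBr.
rewrite (bigD1 i) //= big1 ?addr0 => [|j ji].
  by rewrite dualE ?TG // eqxx mulr1.
have [jT|/wT ->] := boolP (j \in T); last by rewrite mul0r.
by rewrite dualE ?TG // (negPf ji) mulr0.
Qed.

Lemma basis_expand G i : basis centered G ->
  p i - center = \sum_j (if j \in G then dual centered G j 0 i else 0) *: (p j - center).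
Proof.
move=> bG; apply: dot_ext => c; rewrite dot_sumr dotDr dotNr -mul_centered.
have h : (c *m centered <= centered)%MS by exact: submxMl.
rewrite {1}(dual_expand bG h) summxE [LHS]big_mkcond; apply: eq_bigr => j _.
by case: ifP => _; rewrite ?mul0r // mxE mul_centered dotDr dotNr mulrC.
Qed.

Lemma has_dim_facet T : config_facet centered T ->
  has_dim (hull T) ((\rank centered)%:Z - 1).
Proof.
move=> [fT [x [xN x1 xT]]]; have [G bG GT] := full_basis fT.
rewrite -(proj2 bG); apply: has_dim_hull_span => // [|i iT].
  exact: basis_aindep bG _.
exists (fun j => if j \in G then dual centered G j 0 i else 0).
(* The coefficients sum to 1 because the supporting functional equals 1 both at [i] and on [G]. *)
have s1 : \sum_j (if j \in G then dual centered G j 0 i else 0) = 1.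
  have /eqP <- : x 0 i == 1 by rewrite xT.
  rewrite [in RHS](dual_expand bG xN) summxE [RHS]big_mkcond; apply: eq_bigr => j _.
  case: ifP => // jG; rewrite mxE (eqP (_ : x 0 j == 1)) ?mul1r //.
  by rewrite xT (fintype.subsetP GT).
split=> // [j /negPf ->//|].
apply: (addIr (- center)); rewrite (basis_expand _ bG).
under eq_bigr do rewrite scalerBr.
by rewrite sumrB -scaler_suml s1 scale1r.
Qed.

(** A basis in the facet together with a point off it is affinely independent. This excludes the
    improper face when faces of lower dimension are counted. *)
Lemma has_dim_conv_ge T e : config_facet centered T -> T != [set: 'I_n]%SET ->
  has_dim (conv p) e -> (\rank centered)%:Z <= e.
Proof.
move=> [fT [x [xN x1 xT]]] TT; have [G bG GT] := full_basis fT.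
have [i iT] : exists i, i \notin T.
  by move: TT; rewrite -properT => /properP[_ [i _ iT]]; exists i.
have iG : i \notin G by apply: contra iT; apply: (fintype.subsetP GT).
have ind : aindep (i |: G)%SET.
  move=> w wT w0 wp.
  have /centeredP[c cE] := xN.
  have E : \sum_j w j * (1 - x 0 j) = 0.
    rewrite (eq_bigr (fun j => w j * (1 + dot c center) - w j * dot c (p j))) => [|j _].
      by rewrite sumrB -dot_sumr wp dot0r -mulr_suml w0 mul0r subrr.
    by rewrite cE; ring.
  have wi : w i = 0.
    move: E; rewrite (bigD1 i) //= big1 ?addr0 => [/eqP|j ji].
      rewrite mulf_eq0 subr_eq0 [1 == _]eq_sym xT (negPf iT) orbF; by move/eqP.
    have [jG|jG] := boolP (j \in G).
      by rewrite (eqP (_ : x 0 j == 1)) ?subrr ?mulr0 // xT (fintype.subsetP GT).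
    by rewrite wT ?mul0r // !inE negb_or ji jG.
  apply: (basis_aindep bG (fintype.subxx _)) => // j jG.
  by have [->//|ji] := eqVneq j i; rewrite wT // !inE negb_or ji jG.
move=> [k [q [-> qP iq Pq]]].
have le : (#|(i |: G)%SET| <= k)%N.
  apply: (aff_card_le (aindep_enum ind) (q' := q)) => j; apply: Pq.
  by rewrite -hull_setT; apply: hull_point; rewrite finset.in_setT.
by move: le; rewrite cardsU1 iG (proj2 bG) add1n => le; rewrite lerBrDr -PoszD addn1 lez_nat.
Qed.

End Family.
End Hulls.

(** * Cardinalities of sets indexed by finite subsets *)

Section Counting.
Local Open Scope classical_set_scope.
Local Open Scope card_scope.

Lemma card_image_finset (I : finType) (T : Type) (f : I -> T) (S : {set I}) :
  {in S &, injective f} -> f @` [set` S] #= `I_#|S|.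
Proof.
move=> f_inj; apply: (card_eq_trans (B := [set` S])).
  by apply: inj_card_eq => x y /set_mem xS /set_mem yS; apply: f_inj.
have -> : [set` S] = @enum_val _ (mem S) @` [set: 'I_#|S|].
  apply/seteqP; split=> [x /= xS|_ [k _ <-] /=]; last exact: enum_valP.
  by exists (enum_rank_in xS x) => //; rewrite enum_rankK_in.
apply: (card_eq_trans (B := [set: 'I_#|S|])); last by rewrite card_eq_sym card_II.
by apply: inj_card_eq => x y _ _; apply: enum_val_inj.
Qed.

Lemma cardset_image_finset (I : finType) (T : choiceType) (f : I -> T) (S : {set I}) :
  {in S &, injective f} -> cardset (f @` [set` S]) = #|S|.
Proof. by move=> f_inj; apply: card_fset_set; apply: card_image_finset. Qed.

Lemma card_between (T : finType) (A B : {set T}) k :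
  A \subset B -> (#|A| <= k <= #|B|)%N ->
  exists C : {set T}, [/\ A \subset C, C \subset B & #|C| = k].
Proof.
move=> AB /andP[Ak kB].
have : (0 < #|[set D : {set T} | D \subset B :\: A & #|D| == (k - #|A|)%N]%SET|)%N.
  by rewrite cards_draws bin_gt0 cardsD (setIidPr AB) leq_sub2r.
rewrite card_gt0 => /set0Pn[D]; rewrite inE => /andP[DBA /eqP cD].
have [DB dDA] := (fintype.subset_trans DBA (subsetDl _ _), DBA).
rewrite subsetD in dDA; case/andP: dDA => _ dDA.
exists (A :|: D)%SET; split; first exact: finset.subsetUl.
  by rewrite finset.subUset AB.
rewrite cardsU cD (_ : A :&: D = finset.set0)%SET ?cards0 ?subn0 ?subnKC //.
by apply/eqP; rewrite setI_eq0 disjoint_sym.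
Qed.

End Counting.

(** * Face numbers of an almost simplicial configuration *)

Section FaceCount.
Local Open Scope classical_set_scope.
Local Open Scope ring_scope.
Variables (R : realType) (m n : nat) (p : 'I_n -> 'rV[R]_m) (F : {set 'I_n}).
Local Notation d := (\rank (centered p)).
Hypothesis confF : almost_simplicial_config (centered p) F.

Lemma config_setT_neq : F != [set: 'I_n]%SET.
Proof.
have [_ h] := config_dim_lt confF; apply/eqP => E.
by rewrite E cardsT card_ord ltnn in h.
Qed.

Lemma faces_of_other_supports T : T \in faces_of (other_facets (centered p) F) ->
  exists x, supports (centered p) x T.
Proof. by case/faces_ofP=> G GF TG; exact: (sub_facet_supports confF GF TG). Qed.

Lemma has_dim_face_other T : T \in faces_of (other_facets (centered p) F) ->
  has_dim (hull p T) (#|T|%:Z - 1).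
Proof.
case/faces_ofP=> G GF TG; apply: has_dim_hull.
exact: basis_aindep (other_facet_basis confF GF) TG.
Qed.

Lemma hull_inj_supports S T : (exists x, supports (centered p) x S) ->
  (exists x, supports (centered p) x T) -> hull p S = hull p T -> S = T.
Proof.
move=> [x sS] [y sT] E; apply/eqP; rewrite finset.eqEsubset; apply/andP.
split; apply/fintype.subsetP => i /(hull_point p).
  by rewrite E => /(hull_support_mem sT).
by rewrite -E => /(hull_support_mem sS).
Qed.

(** A proper face other than [F] lies in another facet, so it is a simplex with dimension read off
    from its index set. The facet [F] is added separately in dimension d-1. *)
Theorem face_count_config i : (1 <= i <= d)%N ->
  face_count (conv p) (i%:Z - 1) =
    (fcount (faces_of (other_facets (centered p) F)) i + (i == d))%N.
Proof.
move=> /andP[i1 id]; have [_ d0 fF fT] := confF.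
pose K := faces_of (other_facets (centered p) F).
pose S := [set T in K | #|T| == i]%SET.
pose S' := (if i == d then F |: S else S)%SET.
have supF : exists x, supports (centered p) x F by case: fF.
have supS' T : T \in S' -> exists x, supports (centered p) x T.
  have supS : T \in S -> exists x, supports (centered p) x T.
    by rewrite inE => /andP[TK _]; exact: faces_of_other_supports.
  by rewrite /S'; case: ifP => _; [case/setU1P => [->//|]|]; exact: supS.
have FS : F \notin S.
  rewrite inE; apply/negP => /andP[/faces_ofP[G GF FG] _].
  have [bG GnF] := (other_facet_basis confF GF, other_facet_nsub confF GF).
  move/negP: GnF; apply; suff -> : F = G by [].
  apply/eqP; rewrite eqEcard FG (proj2 bG).
  by case: fF => /full_card.
have cS' : #|S'| = (fcount K i + (i == d))%N.
  rewrite /S' /fcount -/S; case: ifP => _; last by rewrite addn0.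
  by rewrite cardsU1 FS addnC.
rewrite -cS' -(cardset_image_finset (f := hull p)); last first.
  by move=> T T' /supS' h /supS' h'; apply: hull_inj_supports.
congr cardset; apply/seteqP; split=> [G [GP Gdim]|_ [T /= TS' <-]].
  have [T [GE]] := face_supports GP.
  have TS h : hull p T = h -> T \in S' -> (hull p @` [set` S']) h.
    by move=> <- TS'; exists T.
  case=> [TT|sT].
    have := has_dim_conv_ge fF config_setT_neq (e := i%:Z - 1).
    by rewrite -hull_setT -TT -GE => /(_ Gdim); lia.
  apply: TS => //; have [TF|TF] := eqVneq T F.
    have e : i = d.
      have := has_dim_unique Gdim; rewrite GE TF => /(_ _ (has_dim_facet fF)).
      by move/addIr => [].
    by rewrite /S' e eqxx TF !inE eqxx.
  have [x sx] := sT; have [H HF TH] := other_facet_above confF sx TF.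
  have TK : T \in K by apply/faces_ofP; exists H.
  have cT : #|T| = i.
    have := has_dim_unique Gdim; rewrite GE => /(_ _ (has_dim_face_other TK)).
    by move/addIr => [].
  have TSS : T \in S by apply/setIdP; rewrite cT.
  by rewrite /S'; case: ifP => // _; rewrite finset.in_setU TSS orbT.
split.
  by have [x sx] := supS' T TS'; rewrite -hull_setT; exact: supports_face sx (finset.subsetT _).
have dimS : T \in S -> has_dim (hull p T) (i%:Z - 1).
  by move=> /setIdP[TK /eqP <-]; exact: has_dim_face_other.
move: TS'; rewrite /S'; case: eqP => [E|_]; last exact: dimS.
case/setU1P => [->|]; last exact: dimS.
by rewrite E; exact: has_dim_facet.
Qed.

End FaceCount.

(** * Farkas' lemma and the vertices of a polytope *)

Section Separation.
Local Open Scope classical_set_scope.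
Local Open Scope ring_scope.
Variable R : realType.

Fixpoint in_cone m (vs : seq 'rV[R]_m) (x : 'rV[R]_m) : Prop :=
  if vs is v :: vs' then exists2 a, 0 <= a & in_cone vs' (x - a *: v) else x = 0.

Lemma in_cone_shift m (vs : seq 'rV[R]_m) (k : 'rV[R]_m -> R) v z :
  (forall u, u \in vs -> k u <= 0) -> in_cone [seq u - k u *: v | u <- vs] z ->
  exists2 s, s <= 0 & in_cone vs (z + s *: v).
Proof.
elim: vs z => [|u vs IH] z kv /=.
  by move=> ->; exists 0 => //; rewrite scale0r addr0.
case=> a a0 /IH[|s s0 hs]; first by move=> u' u'vs; apply: kv; rewrite inE u'vs orbT.
exists (s + a * k u).
  have : a * k u <= 0 by rewrite mulr_ge0_le0 // kv // inE eqxx.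
  lra.
exists a => //; congr (in_cone vs _): hs; apply/rowP => j; rewrite !mxE; ring.
Qed.

(** Induction on the number of generators. When the functional [c] found for the tail is negative on
    [v], everything is projected along [v] onto the kernel of [c]: a conic representation lifts with
    nonnegative coefficient at [v], and a separating functional pulls back. *)
Lemma farkas m (vs : seq 'rV[R]_m) x : in_cone vs x \/
  exists c, (forall v, v \in vs -> 0 <= dot c v) /\ dot c x < 0.
Proof.
have [k] := ubnP (size vs); elim: k => // k IH in vs x *.
case: vs => [|v vs] /=; rewrite ?ltnS => szv.
  have [->|x0] := eqVneq x 0; [by left|right; exists (- x)].
  split=> //; rewrite dotC dotNr oppr_lt0 lt_neqAle sumr_ge0 ?andbT => [|j _]; last first.
    by rewrite -expr2 sqr_ge0.
  rewrite eq_sym psumr_eq0 => [|j _]; last by rewrite -expr2 sqr_ge0.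
  apply: contra x0 => /allP h; apply/eqP/rowP => j; rewrite mxE; apply/eqP.
  by have := h j (mem_index_enum _); rewrite mulf_eq0 orbb.
have [h|[c [cvs cx]]] := IH vs x szv.
  by left; exists 0 => //; rewrite scale0r subr0.
have [cv|cv] := lerP 0 (dot c v).
  by right; exists c; split=> // u; rewrite inE => /orP[/eqP->|/cvs].
pose k' u := dot c u / dot c v.
have kvs u : u \in vs -> k' u <= 0.
  by move=> /cvs cu; rewrite /k' mulr_ge0_le0 // invr_le0 ltW.
have szv' : (size [seq (u - k' u *: v)%R | u <- vs] < k)%N by rewrite size_map.
have [h|[c' [c'vs c'x]]] := IH _ (x - k' x *: v) szv'.
  have [s s0 hs] := in_cone_shift kvs h; left; exists (k' x - s).
    have : 0 <= k' x by rewrite /k' mulr_le0 ?invr_le0 // ltW.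
    lra.
  congr (in_cone vs _): hs; apply/rowP => j; rewrite !mxE; ring.
right; exists (c' - (dot c' v / dot c v) *: c).
have E u : dot (c' - (dot c' v / dot c v) *: c) u = dot c' (u - k' u *: v).
  rewrite dotC dotDr dotNr dotZr !(dotC u) dotDr dotNr dotZr /k'; ring.
split=> [u|]; rewrite E //.
rewrite inE => /orP[/eqP->|uvs]; last by apply: c'vs; apply: map_f.
by rewrite /k' divff ?lt_eqF // scale1r subrr dot0r.
Qed.

Lemma in_cone_comb m (I : eqType) (f : I -> 'rV[R]_m) (s : seq I) x : uniq s ->
  in_cone [seq f i | i <- s] x -> exists w : I -> R,
    [/\ forall i, 0 <= w i, forall i, i \notin s -> w i = 0 &
        x = \sum_(i <- s) w i *: f i].
Proof.
elim: s x => [|i s IH] x /=; first by move=> _ ->; exists (fun=> 0); rewrite big_nil.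
move=> /andP[ni us] [a a0 /(IH _ us)[w [w0 ws xE]]].
exists (fun j => if j == i then a else w j); split.
- by move=> j; case: eqP.
- by move=> j; rewrite inE negb_or => /andP[/negPf-> /ws].
rewrite big_cons eqxx; apply: (addIr (- (a *: f i))); rewrite xE addrC addrA addNr add0r.
apply: eq_big_seq => j js.
by case: eqP => // ji; rewrite -ji js in ni.
Qed.

Lemma hull_separation m n (p : 'I_n -> 'rV[R]_m) (T : {set 'I_n}) x : ~ hull p T x ->
  exists c, forall i, i \in T -> dot c (p i) < dot c x.
Proof.
(* Lifting the points to height 1 turns convex combinations into conic ones. *)
move=> nx; pose lift (y : 'rV[R]_m) : 'rV[R]_(1 + m) := row_mx 1%:M y.
have dot_lift (c : 'rV[R]_(1 + m)) y : dot c (lift y) = c 0 0 + dot (rsubmx c) y.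
  rewrite /dot big_split_ord /= big_ord1 row_mxEl mxE eqxx mulr1; congr (c _ _ + _).
    by apply/val_inj.
  by apply: eq_bigr => j _; rewrite row_mxEr mxE.
have [h|[c [cT cx]]] := farkas [seq lift (p i) | i <- enum T] (lift x).
  case: nx; have [w [w0 wT E]] := in_cone_comb (enum_uniq _) h.
  have wT' i : i \notin T -> w i = 0 by move=> iT; rewrite wT // mem_enum.
  have {}E : lift x = \sum_i w i *: lift (p i).
    rewrite E big_enum big_mkcond; apply: eq_bigr => i _.
    by case: ifPn => // /wT' ->; rewrite scale0r.
  exists w; split=> //.
    have := congr1 (fun M : 'rV[R]_(1 + m) => M 0 (lshift m 0)) E.
    rewrite row_mxEl mxE eqxx summxE => E1; rewrite -[RHS]/(true%:R) E1; apply: eq_bigr => i _.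
    by rewrite mxE row_mxEl mxE eqxx mulr1.
  apply/rowP => j; have := congr1 (fun M : 'rV[R]_(1 + m) => M 0 (rshift 1 j)) E.
  rewrite row_mxEr => ->; rewrite !summxE; apply: eq_bigr => i _.
  by rewrite !mxE -[RHS]/(w i * p i 0 j) -(row_mxEr 1%:M (p i)) // mxE.
exists (- rsubmx c) => i iT.
have /cT : lift (p i) \in [seq lift (p i) | i <- enum T].
  by apply/mapP; exists i; rewrite ?mem_enum.
by move: cx; rewrite !dot_lift ![dot (- _) _]dotC !dotNr ![dot _ (rsubmx c)]dotC; lra.
Qed.

(** In a generating subset of least size no point is in the hull of the others; separation then
    shows each of them to be a vertex, and every vertex belongs to the generators. *)
Lemma polytope_vertices m n (P : set 'rV[R]_m) : polytope P ->
  (vertices P #= `I_n)%card ->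
  exists p : 'I_n -> 'rV[R]_m, [/\ injective p, P = conv p &
    forall i, vertices P (p i)].
Proof.
move=> [k [q ->]] cP.
have ex : exists j, `[< exists2 T : {set 'I_k}, #|T| = j & hull q T = conv q >].
  by exists #|[set: 'I_k]%SET|; apply/asboolP; exists [set: 'I_k]%SET; rewrite ?hull_setT.
have [j /asboolP[T cT hT] jmin] := ex_minnP ex.
have Tmin i : i \in T -> ~ hull q (T :\ i)%SET (q i).
  move=> iT [u [u0 uT u1 uE]].
  suff E : hull q (T :\ i)%SET = conv q.
    have : (j <= #|(T :\ i)%SET|)%N by apply: jmin; apply/asboolP; exists (T :\ i)%SET.
    by rewrite -cT (cardsD1 i T) iT ltnn.
  rewrite -hT; apply/seteqP; split; first by apply: hull_sub; exact: subD1set.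
  move=> x [w [w0 wT w1 xE]].
  have ui : u i = 0 by apply: uT; rewrite !inE eqxx.
  (* The weight of [q i] is redistributed according to its expression by the other points. *)
  exists (fun l => (if l == i then 0 else w l) + w i * u l); split.
  - by move=> l; rewrite addr_ge0 ?mulr_ge0 //; case: ifP.
  - move=> l lT; rewrite uT // mulr0 addr0; case: eqVneq => // li; apply: wT.
    by apply: contra lT => lT; rewrite !inE li.
  - rewrite big_split -mulr_sumr u1 mulr1 -[RHS]w1 [RHS](bigD1 i) //= addrC; congr (_ + _).
    by rewrite (bigD1 i) //= eqxx add0r; apply: eq_bigr => l /negPf ->.
  rewrite xE; under [RHS]eq_bigr do rewrite scalerDl -scalerA.
  rewrite big_split -scaler_sumr -uE (bigD1 i) //= addrC; congr (_ + _).
  rewrite [RHS](bigD1 i) //= eqxx scale0r add0r.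
  by apply: eq_bigr => l /negPf ->.
have q_inj : {in T &, injective q}.
  move=> i i' iT i'T E; apply/eqP; apply: contraT => ii'; case: (Tmin i iT).
  by rewrite E; apply: hull_point; rewrite !inE i'T eq_sym ii'.
have vT i : i \in T -> vertices (conv q) (q i).
  move=> iT; have [c cT'] := hull_separation (Tmin i iT).
  rewrite /vertices /= -hT; apply/face_hullP; exists c, (dot c (q i)); split.
    move=> l lT; have [->//|li] := eqVneq l i.
    by rewrite ltW // cT' // !inE li.
  have -> : tight q T c (dot c (q i)) = [set i]%SET.
    apply/setP => l; rewrite !inE; have [->|li] := eqVneq l i; first by rewrite iT eqxx.
    by apply/negP => /andP[lT]; rewrite lt_eqF // cT' // !inE li.
  apply/seteqP; split=> x; first by move=> ->; apply: hull_point; rewrite !inE.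
  case=> w [w0 w' w1 ->] /=; rewrite (bigD1 i) //= big1 ?addr0 => [|l li].
    move: w1; rewrite (bigD1 i) //= big1 ?addr0 => [->|l li]; first by rewrite scale1r.
    by rewrite w' // inE.
  by rewrite w' ?scale0r // inE.
have vE : vertices (conv q) = q @` [set` T].
  apply/seteqP; split=> [|_ [i iT <-]]; last exact: vT.
  by rewrite -{1}hT; exact: vertices_hull_sub.
have cTn : #|T| = n.
  apply/card_eq_II.
  apply: card_eq_trans cP; rewrite card_eq_sym vE.
  exact: card_image_finset.
move: (cTn) => cTn'; rewrite -cTn.
exists (fun l => q (enum_val l)); split.
- by move=> l l' /q_inj E; apply: enum_val_inj; apply: E; exact: enum_valP.
- rewrite -hT; apply/seteqP; split=> x.
    move=> [w [w0 wT w1 xE]]; exists (fun l => w (enum_val l)); split=> //.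
      by rewrite -(sum1_supported wT).
    by rewrite -(sum_supported q wT).
  move=> [w [w0 w1 xE]].
  have [w' w'E w'T] := enum_extend w.
  exists w'; split=> //.
  - move=> i; have [iT|/w'T->//] := boolP (i \in T).
    by rewrite -(enum_rankK_in iT iT) w'E.
  - by rewrite (sum1_supported w'T) -[RHS]w1; apply: eq_bigr => l _; rewrite w'E.
  by rewrite (sum_supported _ w'T) xE; apply: eq_bigr => l _; rewrite w'E.
by move=> l; apply: vT; exact: enum_valP.
Qed.

End Separation.

(** * Almost simplicial polytopes *)

Section AlmostSimplicial.
Local Open Scope classical_set_scope.
Local Open Scope ring_scope.

(** The points relative to the barycentre span the same space as the differences of an affine basis
    of the hull. *)
Lemma rank_centered (R : realType) m n (p : 'I_n -> 'rV[R]_m) (e : nat) :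
  has_dim (conv p) e%:Z -> \rank (centered p) = e.
Proof.
case=> k [q [ek qP iq Pq]].
have {ek} ek : k = e.+1 by lia.
subst k.
pose o := center p; pose M := (centered p)^T.
have rowM i : row i M = p i - o by apply/rowP => j; rewrite !mxE.
pose Q : 'M[R]_(e, m) := \matrix_j (q (lift ord0 j) - q ord0).
have fQ : row_free Q.
  apply: inj_row_free => a aQ.
  pose w (j : 'I_e.+1) := if unlift ord0 j is Some j' then a 0 j' else - \sum_j' a 0 j'.
  have w_lift j : w (lift ord0 j) = a 0 j by rewrite /w liftK.
  have w_ord0 : w ord0 = - \sum_j a 0 j by rewrite /w unlift_none.
  apply/rowP => j; rewrite mxE -w_lift; apply: iq.
    by rewrite big_ord_recl; under eq_bigr do rewrite w_lift; rewrite w_ord0 addNr.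
  rewrite -[RHS]aQ mulmx_sum_row big_ord_recl.
  under eq_bigr do rewrite w_lift.
  rewrite w_ord0.
  under [RHS]eq_bigr do rewrite rowK scalerBr.
  by rewrite sumrB -scaler_suml scaleNr addrC.
have conv_sub x y : conv p x -> conv p y -> (x - y <= M)%MS.
  move=> [w [_ w1 ->]] [w' [_ w'1 ->]].
  have -> : \sum_i w i *: p i - \sum_i w' i *: p i = \sum_i (w i - w' i) *: (p i - o).
    under [RHS]eq_bigr do rewrite scalerBr scalerBl.
    by rewrite !sumrB -scaler_suml sumrB w1 w'1 subrr scale0r subr0.
  by apply: summx_sub => i _; rewrite scalemx_sub // -rowM row_sub.
have conv_point i : conv p (p i).
  by rewrite -hull_setT; apply: hull_point; rewrite finset.in_setT.
have n0 : (n%:R : R) != 0.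
  have := qP ord0; rewrite -hull_setT => /hull_nonempty[i _].
  by rewrite pnatr_eq0 -lt0n (leq_trans _ (ltn_ord i)).
have point_sub i : (p i - q ord0 <= Q)%MS.
  have [w [w1 ->]] := Pq _ (conv_point i).
  have -> : \sum_j w j *: q j - q ord0 = \sum_j w j *: (q j - q ord0).
    under [RHS]eq_bigr do rewrite scalerBr.
    by rewrite sumrB -scaler_suml w1 scale1r.
  apply: summx_sub => j _; rewrite scalemx_sub //.
  have [j' ->|->] := unliftP ord0 j; last by rewrite subrr sub0mx.
  by rewrite -[X in (X <= _)%MS](rowK (fun j => q (lift ord0 j) - q ord0)) row_sub.
have center_sub : (o - q ord0 <= Q)%MS.
  have -> : o - q ord0 = n%:R^-1 *: \sum_i (p i - q ord0).
    rewrite sumrB sumr_const card_ord scalerBr -[q ord0 *+ n]scaler_nat scalerA.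
    by rewrite mulVf // scale1r.
  by rewrite scalemx_sub // summx_sub.
have QM : (Q <= M)%MS by apply/row_subP => j; rewrite rowK conv_sub.
have MQ : (M <= Q)%MS.
  apply/row_subP => i; rewrite rowM.
  have -> : p i - o = (p i - q ord0) - (o - q ord0) by rewrite opprB addrA subrK.
  by rewrite addmx_sub // eqmx_opp.
have EQ : \rank M = e.
  move: (mxrankS QM) (mxrankS MQ); rewrite (eqP fQ) => le1 le2.
  by apply/eqP; rewrite eqn_leq le1 le2.
by rewrite -EQ mxrank_tr.
Qed.

(** The supporting functional is 1 on the face, so its affine hull misses the barycentre. Hence d
    affinely independent points in it are linearly independent relative to the barycentre, and
    span. *)
Lemma full_of_dim (R : realType) m n (p : 'I_n -> 'rV[R]_m) x T :
  supports (centered p) x T ->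
  has_dim (hull p T) ((\rank (centered p))%:Z - 1) -> full (centered p) T.
Proof.
move=> [/centeredP[c0 c0x] x1 xT] [k [q [ek qT iq Tq]]].
have {ek} ek : k = \rank (centered p) by lia.
pose o := center p; pose M := (centered p)^T.
have rowM i : row i M = p i - o by apply/rowP => j; rewrite !mxE.
have qE j : exists w : 'I_n -> R, [/\ forall i, i \notin T -> w i = 0,
    \sum_i w i = 1 & q j - o = \sum_i w i *: (p i - o)].
  have [w [_ wT w1 qE]] := qT j; exists w; split=> //.
  under eq_bigr do rewrite scalerBr.
  by rewrite sumrB -scaler_suml w1 scale1r qE.
have dot_q c j y : (forall i, i \in T -> dot c (p i) - dot c o = y) -> dot c (q j - o) = y.
  move=> cy; have [w [wT w1 ->]] := qE j.
  transitivity ((\sum_i w i) * y); last by rewrite w1 mul1r.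
  rewrite dot_sumr mulr_suml; apply: eq_bigr => i _.
  have [iT|/wT ->] := boolP (i \in T); last by rewrite !mul0r.
  by rewrite dotDr dotNr cy.
pose Q : 'M[R]_(k, m) := \matrix_j (q j - o).
have fQ : row_free Q.
  apply: inj_row_free => a aQ.
  have a0 : \sum_j a 0 j * dot c0 (q j - o) = 0.
    transitivity (dot c0 (a *m Q)); last by rewrite aQ dot0r.
    rewrite -dot_sumr mulmx_sum_row; congr dot.
    by apply: eq_bigr => j _; rewrite rowK.
  have {}a0 : \sum_j a 0 j = 0.
    rewrite -[RHS]a0; apply: eq_bigr => j _.
    by rewrite (dot_q c0 j 1) ?mulr1 // => i iT; rewrite -c0x; apply/eqP; rewrite xT.
  apply/rowP => j; rewrite mxE; apply: (iq (a 0)) => //.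
  rewrite -[RHS]aQ mulmx_sum_row.
  under [RHS]eq_bigr do rewrite rowK scalerBr.
  by rewrite sumrB -scaler_suml a0 scale0r subr0.
have QM : (Q <= M)%MS.
  apply/row_subP => j; rewrite rowK; have [w [_ _ ->]] := qE j.
  by apply: summx_sub => i _; rewrite scalemx_sub // -rowM row_sub.
have MQ : (M <= Q)%MS.
  have [_ <-] := mxrank_leqif_sup QM.
  by rewrite mxrank_tr (eqP fQ) ek.
move=> y /centeredP[c cy] y0.
have Q0 : Q *m c^T = 0.
  apply/colP => j; rewrite [RHS]mxE; rewrite -[RHS](dot_q c j 0) => [|i iT].
    by rewrite mxE; apply: eq_bigr => l _; rewrite !mxE mulrC.
  by rewrite -cy y0.
have M0 : M *m c^T = 0 by have /submxP[D ->] := MQ; rewrite -mulmxA Q0 mulmx0.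
apply/rowP => i; rewrite mxE cy -dotNr -dotDr -rowM.
have := congr1 (fun Z : 'cV[R]_n => Z i 0) M0; rewrite !mxE => E; rewrite -[RHS]E.
by apply: eq_bigr => l _; rewrite !mxE mulrC.
Qed.

Section Polytope.
Variables (R : realType) (m d n s : nat) (P F : set 'rV[R]_m).
Hypotheses (d_gt0 : (0 < d)%N) (PF : almost_simplicial d n s P F).
Variable p : 'I_n -> 'rV[R]_m.
Hypotheses (p_inj : injective p) (PE : P = conv p) (pv : forall i, vertices P (p i)).

Lemma polytope_rank : \rank (centered p) = d.
Proof. by apply: rank_centered; rewrite -PE; case: PF => -[]. Qed.

Lemma vertices_sub_hull T : vertices (hull p T) = p @` [set` T].
Proof. by apply: vertices_hull => i _; rewrite -PE. Qed.

Lemma hull_inj : injective (hull p).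
Proof.
move=> S T E; apply/setP => i; apply/idP/idP => iS.
  have : vertices (hull p S) (p i) by rewrite vertices_sub_hull; exists i.
  by rewrite E vertices_sub_hull => -[j /= jT /p_inj <-].
have : vertices (hull p T) (p i) by rewrite vertices_sub_hull; exists i.
by rewrite -E vertices_sub_hull => -[j /= jT /p_inj <-].
Qed.

Lemma card_vertices_hull T i : (vertices (hull p T) #= `I_i)%card <-> #|T| = i.
Proof.
have h : (vertices (hull p T) #= `I_#|T|)%card.
  by rewrite vertices_sub_hull; apply: card_image_finset => x y _ _ /p_inj.
split=> [h'|<- //]; apply/card_eq_II; apply: card_eq_trans h'.
by rewrite card_eq_sym.
Qed.

Lemma facet_config (H : set 'rV[R]_m) : facet d P H ->
  exists2 T, config_facet (centered p) T & H = hull p T.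
Proof.
case=> fH dH; move: fH; rewrite {1}PE => /face_supports[T [HE hT]].
exists T => //; case: hT => [TT|[x sx]].
  have [[_ dP] _ _ _ _] := PF.
  have := has_dim_unique dH (e' := d%:Z).
  by rewrite HE TT hull_setT -PE => /(_ dP); lia.
split; last by exists x.
by apply: (full_of_dim sx); rewrite polytope_rank -HE.
Qed.

Lemma config_facetE T : config_facet (centered p) T -> facet d P (hull p T).
Proof.
move=> fT; split; last by rewrite -polytope_rank; exact: has_dim_facet.
by case: fT => _ [x sx]; rewrite PE -hull_setT; exact: supports_face sx (finset.subsetT _).
Qed.

Lemma almost_simplicial_configP : exists TF,
  [/\ F = hull p TF, almost_simplicial_config (centered p) TF & #|TF| = (d + s)%N].
Proof.
have [_ _ fF cF sP] := PF; have [TF fTF FE] := facet_config fF.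
exists TF; split=> //; last by apply/card_vertices_hull; rewrite -FE.
split=> //; [exact: sum_centered|by rewrite polytope_rank|move=> T fT].
have [->|TTF] := eqVneq T TF; [by left|right].
have [|k [q [iq TE]]] := sP _ (config_facetE fT).
  by rewrite FE => /hull_inj /eqP; rewrite (negPf TTF).
have iq' : aindep q [set: 'I_k]%SET by move=> w _; apply: iq.
have := has_dim_hull iq'; rewrite hull_setT -TE cardsT card_ord => dk.
have {dk} kd : k = d.
  have := has_dim_unique dk (has_dim_facet fT); rewrite polytope_rank.
  by move/addIr => [].
apply/eqP; rewrite polytope_rank eqn_leq -{2}polytope_rank full_card ?andbT; last by case: fT.
(* The vertices of the facet are among the d points [q], which bounds their number by d. The default
   index serves only off [T]. *)
have /choice[f fP] : forall i, exists j, i \in T -> q j = p i.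
  move=> i; have [iT|iT] := boolP (i \in T).
    have : vertices (conv q) (p i) by rewrite -TE vertices_sub_hull; exists i.
    by rewrite -hull_setT => /vertices_hull_sub[j _ qj]; exists j.
  have d0 : (0 < k)%N by rewrite kd.
  by exists (Ordinal d0).
rewrite -kd -[X in (_ <= X)%N]card_ord; apply: (@leq_card_in _ _ f (mem T)) => i j iT jT E.
by apply: p_inj; rewrite -!fP // E.
Qed.

Lemma complex_count_boundary TF i : F = hull p TF ->
  almost_simplicial_config (centered p) TF ->
  complex_count (boundary_minus d P F) i =
    fcount (faces_of (other_facets (centered p) TF)) i.
Proof.
move=> FE confF; rewrite /fcount -(cardset_image_finset (f := hull p)); last first.
  by move=> S T _ _; exact: hull_inj.
congr cardset; apply/seteqP; split=> [G [[H [fH HF HG]] cG]|_ [T /= /setIdP[TK /eqP cT] <-]].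
  have [S fS HE] := facet_config fH.
  move: HG; rewrite HE => /face_hullP[c [b [_ GE]]].
  exists (tight p S c b); last by rewrite GE.
  apply/setIdP; split; last by apply/eqP/card_vertices_hull; rewrite -GE.
  apply/faces_ofP; exists S; last by apply/fintype.subsetP => j; rewrite inE => /andP[].
  by apply/other_facetsP; split=> // SF; apply: HF; rewrite HE SF.
have [x sx] := faces_of_other_supports confF TK.
split; last by apply/card_vertices_hull.
case/faces_ofP: TK => S SK TS; exists (hull p S); split.
- by apply: config_facetE; case/other_facetsP: SK.
- by rewrite FE => /hull_inj E; case/other_facetsP: SK.
exact: supports_face sx TS.
Qed.

(** This face number makes every k-set a face; a smaller set extends to a k-set, as k <= n, and
    [faces_of] is closed under subsets. *)
Lemma neighbourly_fcount TF k :
  almost_simplicial_config (centered p) TF -> (k <= n)%N ->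
  fcount (faces_of (other_facets (centered p) TF)) k = 'C(n, k) -> neighbourly k P.
Proof.
move=> confF kn ck S SP Sk.
have all_faces (T : {set 'I_n}) : #|T| = k -> T \in faces_of (other_facets (centered p) TF).
  move=> cT.
  have E : [set T in faces_of (other_facets (centered p) TF) | #|T| == k]%SET =
           [set T : {set 'I_n} | #|T| == k]%SET.
    apply/eqP; rewrite eqEcard card_draws card_ord -ck leqnn andbT.
    by apply/fintype.subsetP => U /setIdP[_ cU]; rewrite inE.
  have : T \in [set T : {set 'I_n} | #|T| == k]%SET by rewrite inE cT.
  by rewrite -E => /setIdP[].
pose T := [set i | `[< S (p i) >]]%SET.
have SE : S = p @` [set` T].
  apply/seteqP; split=> [v Sv|v [i /=]]; last by rewrite inE => /asboolP Si <-.
  have := SP v Sv; rewrite PE -hull_setT => /vertices_hull_sub[i _ iv].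
  by exists i => //=; rewrite inE; apply/asboolP; rewrite iv.
have cT : (#|T| <= k)%N.
  rewrite -card_le_II; apply: card_le_trans Sk; rewrite SE.
  suff /card_eqPle[] : (p @` [set` T] #= `I_#|T|)%card by [].
   apply: card_image_finset => x y _ _; exact: p_inj.
have [T' [TT' _ cT']] : exists T' : {set 'I_n},
    [/\ T \subset T', T' \subset [set: 'I_n]%SET & #|T'| = k].
  by apply: card_between; rewrite ?finset.subsetT // cT cardsT card_ord.
have TK : T \in faces_of (other_facets (centered p) TF).
  have /faces_ofP[G GK T'G] := all_faces T' cT'.
  by apply/faces_ofP; exists G => //; exact: fintype.subset_trans TT' T'G.
exists (hull p T); split; last by rewrite vertices_sub_hull SE.
have [x sx] := faces_of_other_supports confF TK.
by rewrite PE -hull_setT; exact: supports_face sx (finset.subsetT _).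
Qed.

End Polytope.
End AlmostSimplicial.

(** * Divided differences *)

Section DividedDifferences.
Local Open Scope ring_scope.
Variables (R : realFieldType) (n : nat) (u : 'I_n -> R).
Hypothesis u_inj : injective u.
Implicit Types (S T Z : {set 'I_n}) (g : 'I_n -> R) (q : {poly R}).

Definition node_poly S : {poly R} := \prod_(j in S) ('X - (u j)%:P).

Definition lagrange_poly Z g : {poly R} :=
  \sum_(i in Z) (g i / \prod_(j in Z :\ i) (u i - u j)) *: node_poly (Z :\ i).

(** The divided difference in symmetric form, the top coefficient of the interpolation
    polynomial. *)
Definition divdiff Z g : R := \sum_(i in Z) g i / \prod_(j in Z :\ i) (u i - u j).

Lemma node_prod_neq0 S i : i \notin S -> \prod_(j in S) (u i - u j) != 0.
Proof.
move=> iS; apply/prodf_neq0 => j jS; rewrite subr_eq0 (inj_eq u_inj).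
by apply: contraNneq iS => ->.
Qed.

Lemma horner_node_poly S i : (node_poly S).[u i] = \prod_(j in S) (u i - u j).
Proof. by rewrite horner_prod; apply: eq_bigr => j _; rewrite !hornerE. Qed.

Lemma size_node_poly S : size (node_poly S) = #|S|.+1.
Proof.
rewrite /node_poly -big_enum size_prod_XsubC -cardE //.
Qed.

Lemma size_lagrange_poly Z g : (size (lagrange_poly Z g) <= #|Z|)%N.
Proof.
apply: (leq_trans (size_sum _ _ _)); apply/bigmax_leqP => i iZ.
by apply: (leq_trans (size_scale_leq _ _)); rewrite size_node_poly (cardsD1 i Z) iZ.
Qed.

Lemma horner_lagrange_poly Z g i : i \in Z -> (lagrange_poly Z g).[u i] = g i.
Proof.
move=> iZ; have n0 : \prod_(j in Z :\ i) (u i - u j) != 0 by apply: node_prod_neq0; rewrite setD11.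
rewrite horner_sum (bigD1 i) //= hornerZ horner_node_poly divfK //.
rewrite big1 ?addr0 // => k /andP[kZ ki]; rewrite hornerZ horner_node_poly.
have iZk : i \in Z :\ k by rewrite !inE eq_sym ki.
by rewrite [X in _ * X](bigD1 i) //= subrr mul0r mulr0.
Qed.

Lemma coef_lagrange_poly Z g : (lagrange_poly Z g)`_(#|Z|.-1) = divdiff Z g.
Proof.
rewrite coef_sum; apply: eq_bigr => i iZ; rewrite coefZ.
have -> : #|Z|.-1 = (size (node_poly (Z :\ i))).-1.
  by rewrite size_node_poly (cardsD1 i Z) iZ.
rewrite -[X in _ * X]/(lead_coef _) (monicP _) ?mulr1 //.
by rewrite /node_poly -big_enum monic_prod_XsubC.
Qed.

Lemma poly_nodes_eq0 S q : (size q <= #|S|)%N -> (forall i, i \in S -> q.[u i] = 0) -> q = 0.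
Proof.
move=> sq q0; apply/eqP; apply: contraT => qn0.
have r1 : all (root q) [seq u i | i <- enum S].
  by apply/allP => _ /mapP[i iS ->]; rewrite rootE q0 // -mem_enum.
have r2 : uniq [seq u i | i <- enum S] by rewrite map_inj_uniq ?enum_uniq.
by have := max_poly_roots qn0 r1 r2; rewrite size_map -cardE ltnNge sq.
Qed.

Lemma divdiff_poly Z q : (size q < #|Z|)%N -> divdiff Z (fun i => q.[u i]) = 0.
Proof.
move=> sq; pose g i := q.[u i].
have E : lagrange_poly Z g - q = 0.
  apply: (@poly_nodes_eq0 Z) => [|i iZ]; last first.
    by rewrite hornerD hornerN horner_lagrange_poly // subrr.
  apply: (leq_trans (size_polyD _ _)); rewrite size_polyN geq_max size_lagrange_poly.
  exact: ltnW.
rewrite -[LHS]/(divdiff Z g) -coef_lagrange_poly (subr0_eq E) nth_default //.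
by case: #|Z| sq.
Qed.

Lemma divdiffD Z g g' : divdiff Z (fun i => g i + g' i) = divdiff Z g + divdiff Z g'.
Proof. by rewrite -big_split; apply: eq_bigr => i _; rewrite mulrDl. Qed.

Lemma divdiffZ Z a g : divdiff Z (fun i => a * g i) = a * divdiff Z g.
Proof. by rewrite mulr_sumr; apply: eq_bigr => i _; rewrite mulrA. Qed.

(** The remainder formula of interpolation, for a function vanishing at the nodes. *)
Lemma divdiff_vanish S i g : i \notin S -> (forall j, j \in S -> g j = 0) ->
  g i = \prod_(j in S) (u i - u j) * divdiff (i |: S) g.
Proof.
move=> iS g0; rewrite /divdiff [X in _ * X](bigD1 i) ?setU11 //= setU1K // [X in _ + X]big1 ?addr0.
  by rewrite mulrCA divff ?mulr1 // node_prod_neq0.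
by move=> j; rewrite !inE => /andP[/orP[/eqP->|/g0 ->]]; rewrite ?eqxx // mul0r.
Qed.

Lemma divdiff_max Z b g : b \in Z ->
  divdiff Z g = g b / \prod_(j in Z :\ b) (u b - u j) -
                divdiff (Z :\ b) (fun i => g i / (u b - u i)).
Proof.
move=> bZ; rewrite /divdiff (bigD1 b) //= -sumrN; congr (_ + _).
apply: eq_big => [i|i /andP[iZ ib]]; first by rewrite !inE andbC.
rewrite (bigD1 b) /=; last by rewrite !inE eq_sym ib.
have -> : \prod_(j in Z :\ i | j != b) (u i - u j) = \prod_(j in (Z :\ b) :\ i) (u i - u j).
  by apply: eq_bigl => j; rewrite !inE; case: (j == i); case: (j == b); case: (j \in Z).
have n1 : \prod_(j in (Z :\ b) :\ i) (u i - u j) != 0.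
  by apply: node_prod_neq0; rewrite setD11.
have n2 : u b - u i != 0 by rewrite subr_eq0 (inj_eq u_inj) eq_sym.
have n3 : u i - u b != 0 by rewrite subr_eq0 (inj_eq u_inj).
by field; rewrite n1 n2 n3.
Qed.

(* For sufficiently fast growing [g] the terms of the divided difference
   alternate in sign and increase in absolute value, so that the last one
   dominates. *)
Lemma divdiff_bounds (M : R) (e : nat) Z (b : 'I_n) g : 1 <= M ->
  (forall i j : 'I_n, (i < j)%N -> 1 <= u j - u i <= M) ->
  b \in Z -> (forall j : 'I_n, j \in Z -> (j <= b)%N) -> (#|Z| <= e.+2)%N ->
  (forall i, i \in Z -> 0 <= g i) ->
  (forall i j : 'I_n, i \in Z -> j \in Z -> (i < j)%N -> M ^+ e * g i <= g j) ->
  [/\ 0 <= divdiff Z g, divdiff Z g <= g b / \prod_(j in Z :\ b) (u b - u j) &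
      0 < g b -> (forall i : 'I_n, i \in Z -> (i < b)%N -> M ^+ e * g i < g b) ->
      0 < divdiff Z g].
Proof.
move=> M1 uM; have [k] := ubnP #|Z|; elim: k => // k IH in Z b g *.
rewrite ltnS => Zk bZ bmax Ze g0 gM.
have M0 : 0 < M by rewrite (lt_le_trans ltr01).
have ub j : j \in Z :\ b -> 1 <= u b - u j <= M.
  by rewrite !inE => /andP[jb jZ]; apply: uM; rewrite ltn_neqAle jb bmax.
have prod_gt0 (T : {set 'I_n}) (x : 'I_n) : (forall j, j \in T -> (j < x)%N) ->
    0 < \prod_(j in T) (u x - u j).
  by move=> Tx; apply: prodr_gt0 => j /Tx /uM /andP[]; lra.
have Zb_lt j : j \in Z :\ b -> (j < b)%N.
  by rewrite !inE => /andP[jb jZ]; rewrite ltn_neqAle jb bmax.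
have pb := prod_gt0 _ _ Zb_lt.
rewrite (divdiff_max g bZ) //.
have [Y0|[a0 a0Y]] := set_0Vmem (Z :\ b).
  rewrite Y0 /divdiff !big_set0 divr1 subr0; split=> //.
  exact: g0.
case: (@arg_maxnP _ a0 (mem (Z :\ b)) (fun i => nat_of_ord i) a0Y) => a aY amax0.
have amax j : j \in Z :\ b -> (j <= a)%N by exact: amax0.
have {}aY : a \in Z :\ b by [].
pose g' i := g i / (u b - u i).
have aZ : a \in Z by move: aY; rewrite !inE => /andP[].
have ab := Zb_lt a aY.
have uba : 0 < u b - u a by have := ub a aY; lra.
have [| | | |i iY|i j iY jY ij|D0 D1 _] := IH (Z :\ b) a g'.
- by move: Zk; rewrite (cardsD1 b Z) bZ.
- exact: aY.
- by move=> j jY; apply: amax.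
- by rewrite (leq_trans _ Ze) // (cardsD1 b Z) bZ leq_addl.
- rewrite divr_ge0 //; last by have := ub i iY; lra.
  by apply: g0; move: iY; rewrite !inE => /andP[].
(* Dividing by [u b - u i], which decreases in [i], preserves the growth condition. *)
- have [ui uj] := (ub i iY, ub j jY).
  have iZ : i \in Z by move: iY; rewrite !inE => /andP[].
  have jZ : j \in Z by move: jY; rewrite !inE => /andP[].
  have uij := uM i j ij.
  rewrite /g' mulrA ler_pdivrMr; last by lra.
  rewrite mulrAC ler_pdivlMr; last by lra.
  apply: (@le_trans _ _ (g j * (u b - u j))).
    by rewrite ler_wpM2r ?gM //; lra.
  by rewrite ler_wpM2l ?g0 //; lra.
have pa : 0 < \prod_(j in (Z :\ b) :\ a) (u a - u j).
  apply: prod_gt0 => j /setD1P[ja jY].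
  rewrite ltn_neqAle amax // andbT; exact: ja.
have pE : \prod_(j in Z :\ b) (u b - u j) =
    (u b - u a) * \prod_(j in (Z :\ b) :\ a) (u b - u j).
  by rewrite (bigD1 a) //=; congr (_ * _); apply: eq_bigl => j; rewrite !inE andbC.
(* At most [e] factors remain, each with [u b - u j <= M <= M * (u a - u j)]; hence the growth
   factor [M ^+ e]. *)
have ple : \prod_(j in (Z :\ b) :\ a) (u b - u j) <=
    M ^+ e * \prod_(j in (Z :\ b) :\ a) (u a - u j).
  apply: (@le_trans _ _ (\prod_(j in (Z :\ b) :\ a) (M * (u a - u j)))).
    apply: ler_prod => j /setD1P[ja jY].
    have uj := ub j jY.
    have ja' : (j < a)%N by rewrite ltn_neqAle amax // andbT; exact: ja.
    have /andP[ua _] := uM j a ja'.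
    apply/andP; split; first lra.
    have : M * 1 <= M * (u a - u j) by rewrite ler_pM2l.
    lra.
  rewrite big_split prodr_const ler_pM2r // ler_weXn2l //.
  have : (#|(Z :\ b) :\ a|.+2 = #|Z|)%N by rewrite (cardsD1 b Z) bZ (cardsD1 a (Z :\ b)) aY.
  lia.
have {}D1 : divdiff (Z :\ b) g' * \prod_(j in Z :\ b) (u b - u j) <= M ^+ e * g a.
  move: D1; rewrite ler_pdivlMr // => D1; rewrite pE.
  have : divdiff (Z :\ b) g' * \prod_(j in (Z :\ b) :\ a) (u b - u j) <=
      M ^+ e * g' a.
    apply: le_trans (ler_wpM2l D0 ple) _.
    by rewrite mulrCA ler_pM2l // exprn_gt0.
  rewrite /g' mulrA ler_pdivlMr //; lra.
rewrite subr_ge0 ler_pdivlMr // gerBl; split=> //.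
  by apply: le_trans D1 _; apply: gM.
move=> gb0 lt; rewrite subr_gt0 ltr_pdivlMr //.
by apply: le_lt_trans D1 _; apply: lt.
Qed.

Lemma sign_node_prod S i : i \notin S -> (forall i j : 'I_n, (i < j)%N -> u i < u j) ->
  0 < (-1) ^+ #|[set j in S | (i < j)%N]| * \prod_(j in S) (u i - u j).
Proof.
move=> iS ulti.
have -> : (-1) ^+ #|[set j in S | (i < j)%N]| =
    \prod_(j in S) (if (i < j)%N then -1 else 1) :> R.
  rewrite -big_mkcondr /= -prodr_const; apply: eq_bigl => j; by rewrite inE.
rewrite -big_split; apply: prodr_gt0 => j jS /=.
have [ij|ji|ij] := ltngtP i j.
- by rewrite mulN1r oppr_gt0 subr_lt0 ulti.
- by rewrite mul1r subr_gt0 ulti.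
by move/val_inj: ij => ij; rewrite ij jS in iS.
Qed.

End DividedDifferences.

(** * The maximizer *)

Section Gale.
Variable n : nat.
Implicit Types (S T : {set 'I_n}).

Lemma card_initial k : (k <= n)%N -> #|[set i : 'I_n | (i < k)%N]| = k.
Proof.
move=> kn; transitivity #|[set: 'I_k]|; last by rewrite cardsT card_ord.
have wi : injective (widen_ord kn) by move=> x y /(congr1 val) /= /val_inj.
rewrite -(card_imset _ wi); apply: eq_card => i; rewrite inE.
apply/idP/imsetP => [ik|[j _ ->] /=]; last exact: ltn_ord.
by exists (Ordinal ik); rewrite ?finset.in_setT //; apply/val_inj.
Qed.

Definition above S (x : nat) := #|[set j in S | (x < j)%N]|.

Lemma above_setU1 S j x : j \notin S -> above (j |: S) x = ((x < j) + above S x)%N.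
Proof.
move=> jS; rewrite /above; have [xj|xj] := ltnP x j.
  have -> : [set i in j |: S | (x < i)%N] = j |: [set i in S | (x < i)%N].
    by apply/setP => i; rewrite !inE; case: eqP => // ->; rewrite xj.
  by rewrite cardsU1 inE (negPf jS).
apply: eq_card => i; rewrite !inE; case: eqP => //= ->.
by rewrite ltnNge xj (negPf jS).
Qed.

(* Gale's evenness condition: an [e]-set all of whose gaps have an even number
   of elements above them is found by pairing each point of [T] with a
   neighbour, working from the top down. *)
Lemma gale_extend k e T : (k <= n)%N -> (forall i, i \in T -> (i < k)%N) ->
  (2 * #|T| <= e <= k)%N -> exists S,
  [/\ T \subset S, #|S| = e, forall i, i \in S -> (i < k)%N &
      forall x, (x < k)%N -> (forall i, i \in S -> nat_of_ord i <> x) -> ~~ odd (above S x)].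
Proof.
elim/ltn_ind: k e T => -[|k] IH e T kn Tk /andP[Te ek].
  exists finset.set0; split=> //; last by move=> i; rewrite inE.
    by apply/fintype.subsetP => i /Tk.
  by rewrite cards0; lia.
have [ek1|ek1] := eqVneq e k.+1.
  exists [set i : 'I_n | (i < k.+1)%N]; split.
  - by apply/fintype.subsetP => i /Tk; rewrite inE.
  - by rewrite ek1 card_initial.
  - by move=> i; rewrite inE.
  by move=> x xk /(_ (Ordinal (leq_trans xk kn))); rewrite inE => /(_ xk).
have {}ek : (e <= k)%N by lia.
pose top : 'I_n := Ordinal kn.
have [topT|topT] := boolP (top \in T); last first.
  have [||i iT||S [TS cS Sk Sg]] := IH k _ e T; rewrite ?Te //; first exact: ltnW.
    have := Tk i iT; rewrite ltnS leq_eqVlt => /orP[/eqP ik|//].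
    by move: topT; rewrite (_ : top = i) ?iT //; apply/val_inj.
  exists S; split=> // [i /Sk/ltnW //|x]; rewrite ltnS leq_eqVlt => /orP[/eqP -> _|xk].
    rewrite /above (_ : [set j in S | (k < j)%N] = finset.set0) ?cards0 //.
    by apply/setP => i; rewrite !inE; apply/negP => /andP[/Sk]; lia.
  exact: Sg.
have cT : (0 < #|T|)%N by rewrite card_gt0; apply/set0Pn; exists top.
have k0 : (0 < k)%N by lia.
have kn1 : (k.-1 < n)%N by lia.
pose top2 : 'I_n := Ordinal kn1.
pose T' := T :\ top :\ top2.
have T'T : (#|T'| < #|T|)%N.
  by rewrite (cardsD1 top T) topT ltnS subset_leq_card // subD1set.
have T'k i : i \in T' -> (i < k.-1)%N.
  rewrite !inE -!val_eqE /= => /and3P[i2 i1 /Tk]. lia.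
have T'e : (2 * #|T'| <= e - 2 <= k.-1)%N by lia.
have kk : (k.-1 < k.+1)%N by lia.
have [S [TS cS Sk Sg]] := IH k.-1 kk _ T' (ltnW kn1) T'k T'e.
have t2S : top2 \notin S by apply/negP => /Sk /=; rewrite ltnn.
have tS : top \notin top2 |: S.
  rewrite !inE negb_or -val_eqE /=; apply/andP; split; first by lia.
  by apply/negP => /Sk /=; lia.
exists (top |: (top2 |: S)); split.
- apply/fintype.subsetP => i iT; rewrite !inE; apply/orP.
  have [->|it] := eqVneq i top; [by left|right].
  have [->//|it2] := eqVneq i top2; apply: (fintype.subsetP TS).
  by rewrite !inE it it2.
- by rewrite cardsU1 tS cardsU1 t2S cS; lia.
- by move=> i; rewrite !inE => /orP[/eqP->//|/orP[/eqP-> //|/Sk]] /=; lia.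
move=> x xk xS; rewrite !above_setU1 //=.
have x1 : x <> k by move=> E; apply: (xS top); rewrite ?inE ?eqxx.
have x2 : x <> k.-1 by move=> E; apply: (xS top2); rewrite ?inE ?eqxx ?orbT.
have xk' : (x < k.-1)%N by lia.
rewrite (_ : (x < k)%N = true) ?xk'; last by lia.
by rewrite !add1n /= negbK; apply: Sg => // i iS; apply: xS; rewrite !inE iS !orbT.
Qed.

End Gale.

(** * Facets and small faces of C(d,n,s) *)

Section MaximizerConfiguration.
Local Open Scope classical_set_scope.
Local Open Scope ring_scope.
Variables (R : realType) (d n s : nat).
Hypotheses (d_gt0 : (0 < d)%N) (dsn : (d + s < n)%N).
Local Notation t := (tC d s (n := n)).
Local Notation p := (fun i : 'I_n => yC R d n s (t i)).
Implicit Types (i j : 'I_n) (S T : {set 'I_n}) (q : {poly R}).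

Definition node i : R := (t i)%:~R.
Definition height i : R := pC R d n s (t i).
Definition base : {set 'I_n} := [set i : 'I_n | (i < d + s)%N]%SET.

Lemma node_sub i j : node j - node i = j%:R - i%:R.
Proof.
rewrite /node -rmorphB /= (_ : t j - t i = j%:Z - i%:Z) ?rmorphB //.
by rewrite /tC; lia.
Qed.

Lemma node_inj : injective node.
Proof.
move=> i j /eqP; rewrite -subr_eq0 -opprB oppr_eq0 node_sub subr_eq0 eqr_nat.
by move=> /eqP E; apply/val_inj.
Qed.

Lemma node_lt i j : (i < j)%N -> node i < node j.
Proof. by rewrite -subr_gt0 node_sub subr_gt0 ltr_nat. Qed.

Lemma n_sub1 : n%:R - 1 = n.-1%:R :> R.
Proof. by rewrite -subn1 natrB //; lia. Qed.

Lemma node_gap i j : (i < j)%N -> 1 <= node j - node i <= n%:R - 1.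
Proof.
move=> ij; rewrite node_sub -natrB; last exact: ltnW.
by rewrite n_sub1 ler1n ler_nat; have := ltn_ord j; lia.
Qed.

Lemma height_base i : i \in base -> height i = 0.
Proof.
rewrite inE => ids; rewrite /height /pC.
(* Since t = i+1-s-d, the factor t+j of the product vanishes at this j. *)
have jd : (d + s - i.+1 < d + s)%N by lia.
rewrite (bigD1 (Ordinal jd)) //= (_ : t i + (d + s - i.+1)%N%:Z = 0) ?mul0r ?mulr0 //.
by rewrite /tC /=; lia.
Qed.

Lemma heightE i : i \notin base -> height i =
  (n%:R - 1) ^+ ((i - (d + s)) * d.-1) * \prod_(j < d + s) (i - (d + s) + j.+1)%:R.
Proof.
rewrite inE -leqNgt => ids; rewrite /height /pC; congr (_ * _).
  rewrite (_ : (t i - 1) * (d%:Z - 1) = ((i - (d + s)) * d.-1)%N%:Z) //.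
  rewrite /tC PoszM; congr (_ * _); lia.
apply: eq_bigr => j _; rewrite (_ : t i + j%:Z = (i - (d + s) + j.+1)%N%:Z) //.
rewrite /tC; lia.
Qed.

Lemma height_gt0 i : i \notin base -> 0 < height i.
Proof.
move=> ib; rewrite heightE // mulr_gt0 ?exprn_gt0 //.
  by rewrite n_sub1 ltr0n; lia.
by apply: prodr_gt0 => j _; rewrite ltr0n addnS.
Qed.

Lemma height_ge0 i : 0 <= height i.
Proof.
have [ib|ib] := boolP (i \in base); first by rewrite height_base.
exact/ltW/height_gt0.
Qed.

Lemma height_eq0 i : (height i == 0) = (i \in base).
Proof.
have [ib|ib] := boolP (i \in base); first by rewrite height_base ?eqxx.
by rewrite gt_eqF // height_gt0.
Qed.

(** Each step in t gains (n-1)^(d-1) from the exponent (t-1)(d-1), and the product grows strictly.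
    This is the rate that [divdiff_bounds] requires for d+1 nodes. *)
Lemma height_growth i j : (i < j)%N -> j \notin base ->
  (n%:R - 1) ^+ d.-1 * height i < height j.
Proof.
move=> ij jb; have [ib|ib] := boolP (i \in base).
  by rewrite height_base // mulr0 height_gt0.
have [ids jds] : (d + s <= i)%N /\ (d + s <= j)%N by move: ib jb; rewrite !inE -!leqNgt.
have N1 : 1 <= n%:R - 1 :> R.
  by rewrite n_sub1 ler1n; lia.
rewrite !heightE // mulrA -exprD.
apply: (@le_lt_trans _ _ ((n%:R - 1) ^+ ((j - (d + s)) * d.-1) *
   \prod_(k < d + s) (i - (d + s) + k.+1)%:R)).
  rewrite ler_wpM2r //; first by apply: prodr_ge0 => k _; rewrite ler0n.
  rewrite ler_weXn2l // -mulSn leq_mul2r; apply/orP; right; lia.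
rewrite ltr_pM2l ?exprn_gt0 //; last by lra.
apply: ltr_prod => [|k _]; last by rewrite ler0n ltr_nat; lia.
have ds : (0 < d + s)%N by lia.
by apply/hasP; exists (Ordinal ds); rewrite ?mem_index_enum.
Qed.

Lemma divdiff_height_gt0 S i0 : #|S| = d.+1 -> i0 \in S -> i0 \notin base ->
  0 < divdiff node S height.
Proof.
move=> cS i0S i0b.
case: (@arg_maxnP _ i0 (mem S) (fun i => nat_of_ord i) i0S) => b bS bmax0.
have bmax j : j \in S -> (j <= b)%N by exact: bmax0.
have bb : b \notin base.
  by move: (bmax i0 i0S) i0b; rewrite !inE -!leqNgt => le1 le2; apply: leq_trans le1.
have [| | | | | | |_ _ h] := @divdiff_bounds _ _ _ node_inj (n%:R - 1) d.-1 S b height.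
- by rewrite n_sub1 ler1n; lia.
- exact: node_gap.
- exact: bS.
- exact: bmax.
- by rewrite cS; lia.
- by move=> i _; exact: height_ge0.
- move=> i j iS jS ij; have [jb|jb] := boolP (j \in base); last exact/ltW/height_growth.
  have ib : i \in base by move: jb; rewrite !inE => /(ltn_trans ij).
  by rewrite !height_base // mulr0.
by apply: h => [|i iS ib]; [exact: height_gt0|exact: height_growth].
Qed.

(** The last coordinate of the moment curve being replaced by the height, affine functionals become
    a multiple of the height plus a polynomial of degree less than d. *)
Lemma dot_yC c : exists a q, (size q <= d)%N /\
  forall i, dot c (p i) = a * height i + q.[node i].
Proof.
pose last_c := \sum_(j < d | j.+1 == d) c 0 j.
exists last_c, (\sum_(j < d | j.+1 != d) c 0 j *: 'X^(j.+1)); split.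
  apply: (leq_trans (size_sum _ _ _)); apply/bigmax_leqP => j jd.
  apply: (leq_trans (size_scale_leq _ _)); rewrite size_polyXn; have := ltn_ord j; lia.
move=> i; rewrite /dot (bigID (fun j : 'I_d => j.+1 == d)) /=; congr (_ + _).
  rewrite mulr_suml; apply: eq_bigr => j jd; by rewrite mxE jd.
rewrite horner_sum; apply: eq_bigr => j /negPf jd.
by rewrite mxE jd hornerZ hornerXn.
Qed.

Lemma yC_functional a q : (size q <= d)%N -> exists c b,
  forall i, dot c (p i) - b = a * height i + q.[node i].
Proof.
move=> sq; exists (\row_(j < d) if j.+1 == d then a else q`_j.+1), (- q`_0) => i.
rewrite opprK (horner_coef_wide _ sq).
have shift (e : nat) (x : R) (f : nat -> R) : (0 < e)%N ->
    \sum_(j < e) (if j.+1 == e then x else f j.+1) + f 0 = x + \sum_(j < e) f j.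
  case: e => // e _; rewrite big_ord_recr /= eqxx [in RHS]big_ord_recl /=.
  rewrite (eq_bigr (fun j : 'I_e => f j.+1)) => [|j _].
    by rewrite -addrA addrC addrA.
  by rewrite eqSS ltn_eqF // ltn_ord.
rewrite -(shift d _ (fun j : nat => q`_j * node i ^+ j) d_gt0) expr0 mulr1; congr (_ + _).
by apply: eq_bigr => j _; rewrite !mxE; case: ifP.
Qed.

Definition cvalues : 'M[R]_(d, n) := centered p.

Lemma cvaluesP (x : 'rV[R]_n) : (x <= cvalues)%MS <-> \sum_i x 0 i = 0 /\
  exists a q, (size q <= d)%N /\ forall i, x 0 i = a * height i + q.[node i].
Proof.
split=> [xN|[x0 [a [q [sq xE]]]]].
  split; first exact: sum_centered xN.
  have /centeredP[c cE] := xN; have [a [q [sq qE]]] := dot_yC c.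
  exists a, (q - (dot c (center p))%:P); split.
    apply: (leq_trans (size_polyD _ _)); rewrite size_polyN geq_max sq.
    by apply: leq_trans (size_polyC_leq1 _) d_gt0.
  by move=> i; rewrite cE qE hornerD hornerN hornerC addrA.
have [c [b cE]] := yC_functional a sq; apply/centeredP; exists c => i.
suff <- : b = dot c (center p) by rewrite cE xE.
have n0 : n%:R != 0 :> R by rewrite pnatr_eq0; lia.
apply: (mulfI n0); rewrite /center dotZr mulrA divff // mul1r.
rewrite (eq_bigr (fun i => 1 *: p i)) => [|j _]; last by rewrite scale1r.
rewrite dot_sumr; apply/eqP; rewrite eq_sym -subr_eq0.
move: x0; rewrite (eq_bigr _ (fun i _ => xE i)) => x0; rewrite -[X in _ == X]x0.
rewrite mulr_natl -[in b *+ n](card_ord n) -sumr_const -sumrB; apply/eqP.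
by apply: eq_bigr => j _; rewrite mul1r cE.
Qed.

Lemma sum_height_gt0 : 0 < \sum_i height i.
Proof.
pose i0 : 'I_n := Ordinal dsn.
rewrite (bigD1 i0) //= ltr_pwDl ?sumr_ge0 // => [|i _]; last exact: height_ge0.
by apply: height_gt0; rewrite inE ltnn.
Qed.

Lemma cvalues_correct q : (size q <= d)%N -> exists a,
  (\row_i (a * height i + q.[node i])%R <= cvalues)%MS.
Proof.
move=> sq; exists (- (\sum_i q.[node i]) / \sum_i height i); apply/cvaluesP; split.
  under eq_bigr do rewrite mxE.
  by rewrite big_split -mulr_sumr divfK ?gt_eqF ?sum_height_gt0 //= addNr.
by do 2!eexists; split; [exact: sq|move=> i; rewrite mxE].
Qed.

Definition first_nodes : {set 'I_n} := [set i : 'I_n | (i < d)%N]%SET.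

Lemma full_base_sub S : #|S| = d -> S \subset base -> full cvalues S.
Proof.
move=> cS /fintype.subsetP Sb x /cvaluesP[x0 [a [q [sq xE]]]] xS.
have q0 : q = 0.
  apply: (poly_nodes_eq0 node_inj (S := S)); first by rewrite cS.
  by move=> i iS; have := xE i; rewrite xS // (height_base (Sb i iS)) mulr0 add0r.
have {}xE i : x 0 i = a * height i by rewrite xE q0 horner0 addr0.
have a0 : a = 0.
  move: x0; rewrite (eq_bigr _ (fun i _ => xE i)) -mulr_sumr => /eqP.
  by rewrite mulf_eq0 (gt_eqF sum_height_gt0) orbF => /eqP.
by apply/rowP => i; rewrite xE a0 mul0r mxE.
Qed.

Lemma rank_cvalues : \rank cvalues = d.
Proof.
have dn : (d <= n)%N by lia.
have cG : #|first_nodes| = d by exact: card_initial.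
have Gb : first_nodes \subset base.
  by apply/fintype.subsetP => i; rewrite !inE => id; rewrite (leq_trans id) // leq_addr.
have := full_card (full_base_sub cG Gb); rewrite cG => le1.
apply/eqP; rewrite eqn_leq le1 /=.
(* The first d nodes lie in [base], where the height vanishes, so the corrections [a j] do not
   disturb the Lagrange polynomials there. *)
pose l (j : 'I_d) : {poly R} :=
  lagrange_poly node first_nodes (fun i => (i == widen_ord dn j)%:R).
have sl (j : 'I_d) : (size (l j) <= d)%N by rewrite -cG; exact: size_lagrange_poly.
have /choice[a aP] (j : 'I_d) := cvalues_correct (sl j).
pose X : 'M[R]_(d, n) := \matrix_j \row_i (a j * height i + (l j).[node i]).
have XN : (X <= cvalues)%MS by apply/row_subP => j; rewrite rowK.
apply: leq_trans (mxrankS XN); rewrite -{1}(_ : \rank X = d) //; apply/eqP.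
rewrite -/(row_free X); apply: inj_row_free => v vX; apply/rowP => k.
have := congr1 (fun M : 'rV[R]_n => M 0 (widen_ord dn k)) vX; rewrite !mxE => E.
rewrite -[RHS]E (bigD1 k) //= big1 ?addr0 => [|j jk].
  rewrite !mxE height_base ?mulr0 ?add0r; last first.
    by apply: (fintype.subsetP Gb); rewrite inE /=.
  by rewrite horner_lagrange_poly ?eqxx ?mulr1 //; [exact: node_inj|rewrite inE /=].
rewrite !mxE height_base ?mulr0 ?add0r; last first.
  by apply: (fintype.subsetP Gb); rewrite inE /=.
rewrite horner_lagrange_poly; [|exact: node_inj|by rewrite inE /=].
rewrite (_ : (_ == _) = false) ?mulr0 //; apply/negP => /eqP /(congr1 val) /= /val_inj E'.
by rewrite E' eqxx in jk.
Qed.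

Lemma cvalues_supports a q T : (size q <= d)%N -> T != [set: 'I_n]%SET ->
  (forall i, 0 <= a * height i + q.[node i]) ->
  (forall i, (a * height i + q.[node i] == 0) = (i \in T)) ->
  exists x, supports cvalues x T.
Proof.
move=> sq TT z0 zT; have [c [b cE]] := yC_functional a sq.
have cN i : dot (- c) (p i) = - b - (a * height i + q.[node i]).
  by rewrite -cE dotC dotNr dotC; ring.
apply: (@supports_affine _ _ _ p (- c) (- b)) => // i; rewrite cN.
  by have := z0 i; lra.
by rewrite -zT; apply/eqP/eqP; lra.
Qed.

Lemma facet_base : config_facet cvalues base.
Proof.
split.
  have dn : (d <= n)%N by lia.
  apply: full_sub (full_base_sub (card_initial dn) _);
    by apply/fintype.subsetP => i; rewrite !inE => id; rewrite (leq_trans id) // leq_addr.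
apply: (@cvalues_supports 1 0); rewrite ?size_poly0 //.
- apply/eqP => /setP/(_ (Ordinal dsn)); by rewrite !inE ltnn.
- by move=> i; rewrite mul1r horner0 addr0 height_ge0.
by move=> i; rewrite mul1r horner0 addr0 height_eq0.
Qed.

(** Suppose a facet has more than d points, one of them outside [base]; take d+1 including that one.
    The divided difference kills the polynomial part and is positive on the height, so a = 0. The
    polynomial then has too many zeros, and the functional would be constantly 1 although its values
    sum to 0. *)
Lemma cyclic_config : almost_simplicial_config cvalues base.
Proof.
split; rewrite ?rank_cvalues //.
- exact: sum_centered.
- exact: facet_base.
move=> T [fT [x [xN x1 xT]]].
have cT : (d <= #|T|)%N by rewrite -{1}rank_cvalues full_card.
have /cvaluesP[x0 [a [q [sq xE]]]] := xN.
pose q' := q - 1.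
have sq' : (size q' <= d)%N.
  by apply: (leq_trans (size_polyD _ _)); rewrite size_polyN geq_max sq size_poly1.
have yE i : x 0 i - 1 = a * height i + q'.[node i].
  have -> : q'.[node i] = q.[node i] - 1 by rewrite /q' -polyC1 hornerD hornerN hornerC.
  by rewrite xE addrA.
have yT i : i \in T -> a * height i + q'.[node i] = 0.
  by rewrite -xT -yE => /eqP ->; rewrite subrr.
have n0 : (0 < n)%N by lia.
have xn1 : ~ forall i, x 0 i = 1.
  move=> h; move: x0; rewrite (eq_bigr (fun=> 1)) // sumr_const card_ord => /eqP.
  by rewrite pnatr_eq0; lia.
have [Tb|/subsetPn[b bT bb]] := boolP (T \subset base).
  left; apply/eqP; rewrite finset.eqEsubset Tb; apply/fintype.subsetP => i ib.
  have q0 : q' = 0.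
    apply: (poly_nodes_eq0 node_inj (S := T)); first exact: leq_trans cT.
    move=> j jT; have := yT j jT.
    by rewrite height_base ?mulr0 ?add0r //; exact: (fintype.subsetP Tb).
  by rewrite -xT -subr_eq0 yE q0 horner0 addr0 height_base ?mulr0.
right; apply/eqP; rewrite eqn_leq cT andbT leqNgt; apply/negP => dT.
have [Z [bZ ZT cZ]] : exists Z : {set 'I_n},
    [/\ [set b]%SET \subset Z, Z \subset T & #|Z| = d.+1].
  by apply: card_between; rewrite ?sub1set // cards1.
have b_in_Z : b \in Z by rewrite -sub1set.
have a0 : a = 0.
  have : divdiff node Z (fun i => a * height i + q'.[node i]) = 0.
    rewrite /divdiff big1 // => i iZ; rewrite yT ?mul0r //; exact: (fintype.subsetP ZT).
  rewrite divdiffD divdiffZ (divdiff_poly node_inj) ?cZ // addr0 => /eqP.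
  by rewrite mulf_eq0 (gt_eqF (divdiff_height_gt0 cZ b_in_Z bb)) orbF => /eqP.
apply: xn1 => i; apply/eqP; rewrite -subr_eq0 yE a0 mul0r add0r.
rewrite (_ : q' = 0) ?horner0 //.
apply: (poly_nodes_eq0 node_inj (S := T)); first exact: leq_trans cT.
by move=> j jT; rewrite -(yT j jT) a0 mul0r add0r.
Qed.

(** Outside [S], the height minus its interpolation on [S] has the sign of (-1)^(above S i), by the
    remainder formula and the positivity of the divided difference. Constant parity makes it a
    supporting functional: even for lower facets, odd for upper ones. *)
Lemma gale_facet S (e : bool) : #|S| = d -> ~~ (S \subset base) ->
  (forall i, i \notin S -> odd (above S i) = e) -> S \in other_facets cvalues base.
Proof.
move=> cS /subsetPn[b bS bb] Se.
pose r := lagrange_poly node S height.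
pose f i := height i - r.[node i].
have sr : (size r <= d)%N by rewrite -cS; exact: size_lagrange_poly.
have fS i : i \in S -> f i = 0.
  by move=> iS; rewrite /f horner_lagrange_poly ?subrr //; exact: node_inj.
have f_gt0 i : i \notin S -> 0 < (-1) ^+ e * f i.
  move=> iS; rewrite (divdiff_vanish node_inj iS fS).
  have -> : divdiff node (i |: S)%SET f = divdiff node (i |: S)%SET height.
    rewrite (divdiffD node _ height (fun i => - r.[node i])).
    rewrite (_ : divdiff _ _ (fun i => - r.[node i]) = 0) ?addr0 //.
    transitivity (divdiff node (i |: S)%SET (fun i => (-1) * r.[node i])).
      by apply: eq_bigr => j _; rewrite mulN1r.
    by rewrite divdiffZ (divdiff_poly node_inj) ?mulr0 // cardsU1 iS cS.
  have d0 : 0 < divdiff node (i |: S)%SET height.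
    apply: (@divdiff_height_gt0 _ b) => //; first by rewrite cardsU1 iS cS.
    by rewrite finset.in_setU bS orbT.
  rewrite mulrA pmulr_lgt0 //.
  have := sign_node_prod iS node_lt.
  by rewrite -/(above S i) -signr_odd Se.
have fE i : (-1) ^+ e * height i + (- (-1) ^+ e *: r).[node i] = (-1) ^+ e * f i.
  by rewrite hornerZ /f; ring.
have f_ge0 i : 0 <= (-1) ^+ e * f i.
  have [iS|iS] := boolP (i \in S); first by rewrite fS // mulr0.
  exact/ltW/f_gt0.
have [i0 i0S] : exists i0, i0 \notin S.
  apply/existsP; rewrite -negb_forall; apply/negP => /forallP h.
  have : #|S| = n by rewrite -[RHS]card_ord; apply: eq_card => i; rewrite h.
  by rewrite cS; lia.
apply/other_facetsP; split; last first.
  by move=> Sb; rewrite Sb in bS; rewrite bS in bb.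
split.
  move=> x /cvaluesP[x0 [a [q [sq xE]]]] xS.
  have qE : q + a *: r = 0.
    apply: (poly_nodes_eq0 node_inj (S := S)).
      rewrite cS (leq_trans (size_polyD _ _)) // geq_max sq.
      exact: leq_trans (size_scale_leq _ _) sr.
    move=> i iS; rewrite hornerD hornerZ horner_lagrange_poly //; last exact: node_inj.
    by rewrite addrC -xE xS.
  have {}xE i : x 0 i = a * f i.
    by rewrite xE (_ : q = - (a *: r)) ?hornerN ?hornerZ /f; [ring|apply/eqP; rewrite -addr_eq0 qE].
  have a0 : a = 0.
    have : \sum_i (-1) ^+ e * x 0 i = 0 by rewrite -mulr_sumr x0 mulr0.
    rewrite (eq_bigr (fun i => a * ((-1) ^+ e * f i))) => [|i _]; last by rewrite xE; ring.
    rewrite -mulr_sumr => /eqP; rewrite mulf_eq0 => /orP[/eqP//|].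
    by rewrite psumr_eq0 // => /allP/(_ i0 (mem_index_enum _)); rewrite gt_eqF ?f_gt0.
  by apply/rowP => i; rewrite xE a0 mul0r mxE.
apply: (@cvalues_supports ((-1) ^+ e) (- (-1) ^+ e *: r)).
- exact: leq_trans (size_scale_leq _ _) sr.
- by apply: contraNneq i0S => ->; rewrite finset.in_setT.
- by move=> i; rewrite fE.
move=> i; rewrite fE; have [iS|iS] := boolP (i \in S); first by rewrite fS // mulr0 eqxx.
by rewrite gt_eqF // f_gt0.
Qed.

Lemma card_base : #|base| = (d + s)%N.
Proof. by apply: card_initial; exact: ltnW. Qed.

(** [T] is completed to a set with even gaps; its point outside [base] keeps that set from being
    inside [base]. *)
Lemma small_face_off T : (2 * #|T| <= d)%N -> ~~ (T \subset base) ->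
  T \in faces_of (other_facets cvalues base).
Proof.
move=> Td Tb.
have Te : (2 * #|T| <= d <= n)%N by rewrite Td; lia.
have [S [TS cS _ Sg]] := gale_extend (leqnn n) (fun i _ => ltn_ord i) Te.
apply/faces_ofP; exists S => //; apply: (gale_facet (e := false)) => //.
  by apply: contra Tb; apply: fintype.subset_trans.
move=> i iS; apply/negbTE/Sg => // j jS /val_inj ji.
by rewrite -ji jS in iS.
Qed.

(** [T] may lie inside [base], so the last point, which does not, is added. It turns all parities
    odd and uses up one of the d elements, whence the bound d-1. *)
Lemma small_face T : (2 * #|T| <= d - 1)%N -> T \in faces_of (other_facets cvalues base).
Proof.
move=> Td; have ln : (n.-1 < n)%N by lia.
pose last : 'I_n := Ordinal ln.
have T'n i : i \in (T :\ last)%SET -> (i < n.-1)%N.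
  by rewrite !inE -val_eqE /= => /andP[il _]; have := ltn_ord i; lia.
have T'e : (2 * #|(T :\ last)%SET| <= d - 1 <= n.-1)%N.
  have : (#|(T :\ last)%SET| <= #|T|)%N by rewrite subset_leq_card // subD1set.
  lia.
have [S [TS cS Sn Sg]] := gale_extend (leq_pred n) T'n T'e.
have lS : last \notin S by apply/negP => /Sn /=; rewrite ltnn.
apply/faces_ofP; exists (last |: S)%SET; last first.
  apply/fintype.subsetP => i iT; rewrite in_setU1; apply/orP.
  have [->|il] := eqVneq i last; [by left|right].
  by apply: (fintype.subsetP TS); rewrite in_setD1 il.
apply: (gale_facet (e := true)).
- by rewrite cardsU1 lS cS; lia.
- by apply/subsetPn; exists last; [rewrite setU11|rewrite inE /=; lia].
move=> i; rewrite in_setU1 negb_or => /andP[il iS].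
have iln : (i < n.-1)%N by move: il; rewrite -val_eqE /=; have := ltn_ord i; lia.
rewrite above_setU1 // (_ : (i < last)%N = true) // add1n /=; apply: Sg => // j jS /val_inj ji.
by rewrite -ji jS in iS.
Qed.

Lemma fcount_small (i : nat) : (2 * i <= d - 1)%N ->
  fcount (faces_of (other_facets cvalues base)) i = 'C(n, i).
Proof.
move=> id.
have -> : 'C(n, i) = #|[set T : {set 'I_n} | #|T| == i]%SET| by rewrite card_draws card_ord.
apply: eq_card => T.
apply/setIdP/idP => [[_ cT]|]; first by rewrite inE.
by rewrite inE => cT; split=> //; apply: small_face; rewrite (eqP cT).
Qed.

Lemma fcount_off_small (i : nat) : (2 * i <= d)%N ->
  (fcount (faces_off base (other_facets cvalues base)) i + 'C(d + s, i))%N = 'C(n, i).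
Proof.
move=> id.
have -> : 'C(n, i) = #|[set T : {set 'I_n} | #|T| == i]%SET| by rewrite card_draws card_ord.
rewrite -card_base -cards_draws addnC.
rewrite -[RHS](cardsID [set T : {set 'I_n} | T \subset base]%SET); congr (_ + _)%N.
  by apply: eq_card => T; rewrite !inE andbC.
apply: eq_card => T; rewrite finset.in_setD [in RHS]inE [X in _ && X]inE.
apply/setIdP/andP => [[]|[Tb cT]]; first by rewrite inE => /andP[_ ->] ->.
split=> //; rewrite inE Tb andbT; apply: small_face_off => //.
by rewrite (eqP cT).
Qed.

End MaximizerConfiguration.

(** * Comparison with the h-vector of the maximizer *)

Section HVectors.
Local Open Scope nat_scope.
Variables (d n s : nat) (h hC fC gC : nat -> nat).
Hypotheses (d_gt0 : 0 < d) (dsn : d + s < n).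
Hypothesis h_le : forall k, k <= d -> h k <= 'C(n - d - 1 + k, k).
Hypothesis h_rev_le : forall k, k <= d ->
  h (d - k) + 'C(s + k - 1, k) <= 'C(n - d - 1 + k, k).
Hypothesis fCE : forall i, i <= d -> fC i = \sum_(k < d.+1) hC k * 'C(d - k, d - i).
Hypothesis gCE : forall i, i <= d -> gC i = \sum_(k < d.+1) hC (d - k) * 'C(d - k, d - i).
Hypothesis fC_small : forall i, 2 * i <= d - 1 -> fC i = 'C(n, i).
Hypothesis gC_small : forall i, 2 * i <= d -> gC i + 'C(d + s, i) = 'C(n, i).

Lemma maximizer_h k : k <= (d - 1)./2 -> hC k = 'C(n - d - 1 + k, k).
Proof.
move=> kd.
apply: (@bin_triangular_inj d (d - 1)./2 hC (fun k => 'C(n - d - 1 + k, k))) => //; last by lia.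
move=> i id; rewrite -fCE; last by lia.
rewrite fC_small; last by lia.
have -> : 'C(n, i) = 'C(n - d + d, i) by congr binomial; lia.
rewrite -bin_upper_convolution; last by lia.
by apply: eq_bigr => j _; congr (binomial _ _ * _); lia.
Qed.

(** The subsets of [base] missing from the relative complex number binom(d+s, i), which are the face
    numbers of the h-vector binom(s+k-1, k). *)
Lemma maximizer_h_rev k : k <= d./2 ->
  hC (d - k) + 'C(s + k - 1, k) = 'C(n - d - 1 + k, k).
Proof.
move=> kd.
apply: (@bin_triangular_inj d d./2 (fun k => hC (d - k) + 'C(s + k - 1, k))
  (fun k => 'C(n - d - 1 + k, k))) => //; last by lia.
move=> i id.
under eq_bigr do rewrite mulnDl.
rewrite big_split /= -gCE; last by lia.
rewrite bin_upper_convolution; last by lia.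
rewrite [s + d]addnC gC_small; last by lia.
have -> : 'C(n, i) = 'C(n - d + d, i) by congr binomial; lia.
rewrite -bin_upper_convolution; last by lia.
by apply: eq_bigr => j _; congr (binomial _ _ * _); lia.
Qed.

Lemma h_le_maximizer k : k <= d -> h k <= hC k.
Proof.
move=> kd; have [k1|k1] := leqP k (d - 1)./2.
  by rewrite maximizer_h // h_le.
have kd2 : d - k <= d./2 by lia.
have e : k = d - (d - k) by lia.
rewrite e -(leq_add2r 'C(s + (d - k) - 1, d - k)) maximizer_h_rev // h_rev_le //.
exact: leq_subr.
Qed.

Lemma f_le_maximizer i :
  \sum_(k < d.+1) h k * 'C(d - k, d - i) <= \sum_(k < d.+1) hC k * 'C(d - k, d - i).
Proof. by apply: leq_sum => k _; rewrite leq_mul2r h_le_maximizer ?orbT // -ltnS. Qed.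

(** Termwise domination turns equality of the sums into equality of the terms. For k <= (d-1)/2 <= i
    the coefficient binom(d-k, d-i) is positive, so these h-numbers agree, and they determine the
    face number at (d-1)/2. *)
Lemma f_eq_maximizer i : (d - 1)./2 <= i ->
  \sum_(k < d.+1) h k * 'C(d - k, d - i) = \sum_(k < d.+1) hC k * 'C(d - k, d - i) ->
  \sum_(k < d.+1) h k * 'C(d - k, d - (d - 1)./2) = 'C(n, (d - 1)./2).
Proof.
move=> id E; rewrite -fC_small; last by lia.
rewrite fCE; last by lia.
have hE k : k <= (d - 1)./2 -> h k = hC k.
  move=> kd; have kd' : k < d.+1 by lia.
  have /leqif_sum/eq_leqif : forall j : 'I_d.+1, true ->
      h j * 'C(d - j, d - i) <= hC j * 'C(d - j, d - i)
        ?= iff (h j * 'C(d - j, d - i) == hC j * 'C(d - j, d - i)).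
    by move=> j _; split=> //; rewrite leq_mul2r h_le_maximizer ?orbT // -ltnS.
  rewrite E eqxx => /esym/forallP/(_ (Ordinal kd')) /=.
  rewrite eqn_pmul2r ?bin_gt0; last by lia.
  by move/eqP.
apply: eq_bigr => k _; have [kd|kd] := leqP k (d - 1)./2; first by rewrite hE.
by rewrite bin_small ?muln0 //; have := ltn_ord k; lia.
Qed.

End HVectors.

Local Open Scope classical_set_scope.
Local Open Scope ring_scope.

Lemma neighbourly0 (R : realType) m (P : set 'rV[R]_m) : neighbourly 0 P.
Proof.
move=> S _; rewrite II0 card_le0 => /eqP ->; exists classical_sets.set0; split.
  exists 0, 1; split=> [x _|]; first by rewrite big1 // => j _; rewrite mxE mul0r.
  apply/seteqP; split=> // x [_] /=; rewrite big1 => [/eqP|j _]; last by rewrite mxE mul0r.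
  by rewrite eq_sym oner_eq0.
apply/seteqP; split=> // v [c [b [_ /seteqP[/(_ v erefl)]]]].
by case.
Qed.

Theorem theorem4p6 (R : realType) (m d n s : nat) (P F : set 'rV[R]_m)
    (d_gt0 : (0 < d)%N) (PF : almost_simplicial d n s P F) :
  [/\ forall k : nat, (k <= (d - 1)./2)%N ->
        h_number d (boundary_minus d P F) k <= 'C(n - d - 1 + k, k)%:Z,
      forall k : nat, (1 <= k <= d./2)%N ->
        h_number d (boundary_minus d P F) (d - k)
          <= 'C(n - d - 1 + k, k)%:Z - 'C(s + k - 1, k)%:Z,
      forall i : nat, (1 <= i <= d)%N ->
        (face_count P (i%:Z - 1)
          <= face_count (Cpolytope R d n s) (i%:Z - 1))%N
    & (exists i : nat, ((d - 1)./2 <= i <= d)%N /\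
        face_count P (i%:Z - 1) = face_count (Cpolytope R d n s) (i%:Z - 1)) ->
      neighbourly (d - 1)./2 P].
Proof.
have [[polP _] cP _ _ _] := PF.
have [p [p_inj PE pv]] := polytope_vertices polP cP.
have rk := polytope_rank PF PE.
have [TF [FE confF cTF]] := almost_simplicial_configP d_gt0 PF p_inj PE pv.
have [h [fE _ h_le h_rev_le]] := config_h_vector confF.
rewrite rk in fE h_le h_rev_le.
have {}h_rev_le k : (k <= d)%N -> (h (d - k) + 'C(s + k - 1, k) <= 'C(n - d - 1 + k, k))%N.
  by move=> /h_rev_le; rewrite cTF addKn.
have dsn : (d + s < n)%N by rewrite -cTF; case: (config_dim_lt confF).
have hE k : (k <= d)%N -> h_number d (boundary_minus d P F) k = (h k)%:Z.
  move=> kd; rewrite -(bin_inversion h kd); apply: eq_bigr => i _.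
  rewrite (complex_count_boundary d_gt0 PF p_inj PE pv _ FE confF) fE //.
  by have := ltn_ord i; lia.
have confC := cyclic_config R d_gt0 dsn.
have rkC := rank_cvalues R d_gt0 dsn.
have [hC [fCE gCE _ _]] := config_h_vector confC.
rewrite rkC in fCE gCE.
pose fC i := fcount (faces_of (other_facets (cvalues R d n s) (base d n s))) i.
pose gC i := fcount (faces_off (base d n s) (other_facets (cvalues R d n s) (base d n s))) i.
have fC_small i := @fcount_small R d n s d_gt0 dsn i.
have gC_small i := @fcount_off_small R d n s d_gt0 dsn i.
have countP i : (1 <= i <= d)%N ->
    face_count P (i%:Z - 1) = (\sum_(k < d.+1) h k * 'C(d - k, d - i) + (i == d))%N.
  move=> id; rewrite {1}PE (face_count_config confF) rk // fE //.
  by case/andP: id.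
have countC i : (1 <= i <= d)%N -> face_count (Cpolytope R d n s) (i%:Z - 1) =
    (\sum_(k < d.+1) hC k * 'C(d - k, d - i) + (i == d))%N.
  move=> id; rewrite -fCE; last by case/andP: id.
  have := @face_count_config _ _ _ _ _ confC i.
  by rewrite -/(cvalues R d n s) rkC => /(_ id).
split.
- by move=> k kd; rewrite hE ?lez_nat ?h_le //; lia.
- move=> k /andP[k1 kd]; rewrite hE ?leq_subr // lerBrDr -PoszD lez_nat h_rev_le //.
  by lia.
- move=> i id; rewrite countP // countC // leq_add2r.
  exact: (f_le_maximizer d_gt0 dsn h_le h_rev_le fCE gCE fC_small gC_small).
case=> i [/andP[i1 id] E].
have kn : ((d - 1)./2 <= n)%N by lia.
(* [countP] does not cover i = 0; in that case (d-1)/2 = 0 and only the empty face is required. *)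
have [i0|i0] := posnP i.
  have -> : (d - 1)./2 = 0%N by lia.
  exact: neighbourly0.
apply: (neighbourly_fcount p_inj PE pv confF kn).
rewrite fE; last by lia.
apply: (f_eq_maximizer d_gt0 dsn h_le h_rev_le fCE gCE fC_small gC_small i1).
by move: E; rewrite countP ?i0 // countC ?i0 // => /addIn.
Qed.
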